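(* Let $c(x,y)=l(|x-y|)\ge 0$ be a cost function on $\mathbb{R}^d\times\mathbb{R}^d$ satisfying assumptions (A1)–(A4) listed in the context. Suppose that $\mu=\nu$ is a radially symmetric Borel probability measure on $\mathbb{R}^d$, with common density $\rho(x)=\lambda(|x|)$ for all $x\in\mathrm{supp}\,\mu$. Moreover, assume that $\rho(x)>0$ for all $x\in\mathrm{supp}\,\mu$. Then the optimal transport map $T^{(d)}$ has to be radially symmetric itself, that is $$T^{(d)}(x)=g(|x|)\frac{x}{|x|},\qquad x\in\mathbb{R}^d,$$ for some function $g:[0,\infty)\to\mathbb{R}$. Moreover $g\le 0$, and $g$ is an increasing function with $g(0_+)=-\infty$ and $g(+\infty)=0$.
   Context: Cost: $l:[0,\infty]\to[0,\infty]$, $h(x):=l(|x|)$, $c(x,y):=h(x-y)=l(|x-y|)\ge 0$, $\Delta:=\{(x,x): x\in\mathbb{R}^d\}$, with: (A1) $l$ is strictly convex, strictly decreasing and $C^1$ on $(0,\infty)$; (A2) $c\in C^1((\mathbb{R}^d\times\mathbb{R}^d)\setminus\Delta,\mathbb{R})$; (A3) $c:\mathbb{R}^d\times\mathbb{R}^d\to[0,+\infty]$ is lower semicontinuous; (A4) $c(x_0,x_0)=+\infty$ for every $x_0\in\mathbb{R}^d$. The density $\rho:\mathbb{R}^d\to[0,\infty)$ is taken with respect to Lebesgue measure, and $\mathrm{supp}\,\mu$ is the smallest closed set of full $\mu$-measure. $\Gamma(\mu,\mu)$ is the set of Borel probability measures on $\mathbb{R}^d\times\mathbb{R}^d$ with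 both marginals equal to $\mu$. The optimal transport map $T^{(d)}$ is the ($\mu$-a.e. unique) map with $T^{(d)}_{\#}\mu=\mu$ such that $(\mathrm{id},T^{(d)})_{\#}\mu$ is the unique minimizer of $C[\gamma]=\int c(x,y)\,d\gamma(x,y)$ over $\Gamma(\mu,\mu)$; here $T_{\#}\mu(V):=\mu(T^{-1}(V))$. $g(0_+)$ and $g(+\infty)$ denote the limits of $g(r)$ as $r\downarrow0$ and $r\to\infty$.
   Formalization: Dropped where false: g(0_+)=-∞ if supp μ is bounded and contains 0; g(+∞)=0, and g increasing at radii below supp μ, if supp μ is unbounded and omits 0. The form of T holds μ-a.e.; g is nondecreasing on (0,∞), strictly so across radii met by supp μ. *)

(* Defs.v *)
From HB Require Import structures.
From mathcomp Require Import all_boot all_order all_algebra.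
From mathcomp Require Import lra.
From mathcomp Require Import all_classical all_reals all_analysis.
Set Implicit Arguments.
Unset Strict Implicit.
Unset Printing Implicit Defensive.
Import Order.TTheory GRing.Theory Num.Theory.
Import numFieldNormedType.Exports.
Local Open Scope classical_set_scope.
Local Open Scope ring_scope.

Definition rV_display : measure_display.
Proof. exact: default_measure_display. Qed.

Section borel_rV.
Context {R : realType} (d : nat).

Let borel_set0 : <<s @open 'rV[R]_d >> set0.
Proof. exact: sigma_algebra0. Qed.

Let borel_setC A : <<s @open 'rV[R]_d >> A -> <<s @open 'rV[R]_d >> (~` A).
Proof. exact: sigma_algebraC. Qed.

Let borel_bigcup (F : (set 'rV[R]_d)^nat) :
  (forall i, <<s @open 'rV[R]_d >> (F i)) ->
  <<s @open 'rV[R]_d >> (\bigcup_i F i).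
Proof. exact: sigma_algebra_bigcup. Qed.

HB.instance Definition _ := @isMeasurable.Build rV_display 'rV[R]_d
  (<<s @open 'rV[R]_d >>) borel_set0 borel_setC borel_bigcup.

Lemma open_measurable_rV (A : set 'rV[R]_d) : open A -> measurable A.
Proof. exact: sub_sigma_algebra. Qed.

Lemma measurable_coord (i : 'I_d) :
  measurable_fun [set: 'rV[R]_d] (fun v : 'rV[R]_d => v 0 i).
Proof.
apply: (measurability _ (measurable_realfun.RGenOpens.measurableE R)).
move=> _ [_ [a [b ->]] <-].
rewrite setTI; apply: open_measurable_rV; apply: open_comp.
  by move=> v _; exact: coord_continuous.
exact: interval_open.
Qed.

Lemma measurable_fun_rV d' (T : measurableType d') (f : T -> 'rV[R]_d) :
  (forall i, measurable_fun setT (fun t => f t 0 i)) ->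
  measurable_fun setT f.
Proof.
move=> mf; apply: (@measurability _ _ _ _ _ _ (@open 'rV[R]_d)) => //.
move=> _ [U oU <-]; rewrite setTI.
pose q (p : 'rV[rat]_d * nat) : set 'rV[R]_d := [set x | forall i,
  ratr (p.1 0 i) - p.2.+1%:R^-1 < x 0 i < ratr (p.1 0 i) + p.2.+1%:R^-1].
pose I := [set p | q p `<=` U].
have -> : f @^-1` U = \bigcup_(p in I) f @^-1` q p.
  rewrite -preimage_bigcup; congr (f @^-1` _).
  apply/seteqP; split=> [x Ux|x [p Ip /Ip//]].
  have /nbhs_ballP[e /= e0 eU] : nbhs x U by exact: open_nbhs_nbhs.
  have [n ne] : exists n : nat, n.+1%:R^-1 < e / 2.
    have [n _ /(_ _ (leqnn _)) H] :=
      near_infty_natSinv_lt (PosNum (divr_gt0 e0 (ltr0Sn R 1))).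
    by exists n.
  have [k kE] : exists k : R, k = n.+1%:R^-1 by exists n.+1%:R^-1.
  have k0 : 0 < k by rewrite kE invr_gt0.
  rewrite -kE in ne.
  have /choice[c cP] : forall i : 'I_d, exists c : rat,
      x 0 i - k < ratr c < x 0 i + k.
    move=> i; have : x 0 i - k < x 0 i + k by lra.
    by move/rat_in_itvoo => [c]; rewrite in_itv/= => ?; exists c.
  exists (\row_i c i, n) => [y /= cy|i /=]; last first.
    by rewrite mxE -kE; have /andP[] := cP i; lra.
  apply: eU; split => // i j; rewrite ord1 /ball/= ltr_norml.
  by have /andP[] := cP j; have := cy j; rewrite mxE -kE => /andP[]; lra.
rewrite bigcup_mkcond; apply: countable_bigcupT_measurable => // p.
case: ifPn => // _.
have -> : f @^-1` q p = \bigcap_(i in [set: 'I_d]) (fun t => f t 0 i) @^-1`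
    `]ratr (p.1 0 i) - p.2.+1%:R^-1, ratr (p.1 0 i) + p.2.+1%:R^-1[%classic.
  apply/seteqP; split=> [t /= qt i _|t /= qt i]; first by rewrite /= in_itv/=.
  by have := qt i Logic.I; rewrite /= in_itv.
apply: fin_bigcap_measurable => // i _.
by rewrite -[X in measurable X]setTI; exact: mf.
Qed.

End borel_rV.

Section lebesgue_rV.
Context {R : realType}.

Definition rV_cons d (p : measurableTypeR R * 'rV[R]_d) : 'rV[R]_d.+1 :=
  \row_(i < d.+1) if unlift ord0 i is Some j then p.2 0 j else p.1.

Lemma measurable_rV_cons d : measurable_fun setT (@rV_cons d).
Proof.
apply: measurable_fun_rV => i; rewrite /rV_cons.
under eq_fun do rewrite mxE.
case: (unlift ord0 i) => [j|]; last exact: measurable_fst.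
exact: (measurableT_comp (measurable_coord j) measurable_snd).
Qed.

Let rV_uncons d (v : 'rV[R]_d.+1) :
  measurableTypeR R * 'rV[R]_d :=
  (v 0 ord0, \row_j v 0 (lift ord0 j)).

Let rV_consK d : cancel (@rV_cons d) (@rV_uncons d).
Proof.
move=> [t v]; rewrite /rV_uncons /rV_cons; congr (_, _).
  by rewrite mxE unlift_none.
by apply/rowP => j; rewrite !mxE liftK.
Qed.

Let measurable_rV_uncons d : measurable_fun setT (@rV_uncons d).
Proof.
apply/measurable_fun_pair => /=; first exact: measurable_coord.
apply: measurable_fun_rV => i; under eq_fun do rewrite mxE.
exact: measurable_coord.
Qed.

HB.instance Definition _ d :=
  isMeasurableFun.Build _ _ _ _ (@rV_cons d) (@measurable_rV_cons d).

Section lebesgue_step.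
Variables (d : nat) (m : {sigma_finite_measure set 'rV[R]_d -> \bar R}).

Definition lebesgue_step : set 'rV[R]_d.+1 -> \bar R :=
  pushforward (@lebesgue_measure R \x m)%E (@rV_cons d).

Let lebesgue_step0 : lebesgue_step set0 = 0%E.
Proof. by rewrite /lebesgue_step /pushforward preimage_set0 measure0. Qed.

Let lebesgue_step_ge0 A : (0 <= lebesgue_step A)%E.
Proof. by rewrite /lebesgue_step /pushforward measure_ge0. Qed.

Let lebesgue_step_sigma_additive : semi_sigma_additive lebesgue_step.
Proof.
rewrite /lebesgue_step.
exact: measure_semi_sigma_additive.
Qed.

HB.instance Definition _ := isMeasure.Build _ _ _ lebesgue_step
  lebesgue_step0 lebesgue_step_ge0 lebesgue_step_sigma_additive.

Let lebesgue_step_sigma_finite : sigma_finite setT lebesgue_step.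
Proof.
have /sigma_finiteP[F [TF ndF Foo]] := sigma_finiteT (@lebesgue_measure R).
have /sigma_finiteP[G [TG ndG Goo]] := sigma_finiteT m.
exists (fun n => (@rV_uncons d) @^-1` (F n `*` G n)) => [|n].
  rewrite -preimage_bigcup (_ : \bigcup_n _ = setT) ?preimage_setT//.
  apply/seteqP; split=> // -[x y] _.
  have [i _ Fx] : (\bigcup_i F i) x by rewrite -TF.
  have [j _ Gy] : (\bigcup_i G i) y by rewrite -TG.
  exists (maxn i j) => //; split => /=.
    by move: x Fx; apply/subsetPset/ndF/leq_maxl.
  by move: y Gy; apply/subsetPset/ndG/leq_maxr.
have [mF Fn] := Foo n; have [mG Gn] := Goo n; split.
  rewrite -[X in measurable X]setTI; apply: measurable_rV_uncons => //.
  exact: measurableX.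
rewrite /lebesgue_step /pushforward -comp_preimage.
rewrite [X in X @^-1` _](_ : _ = id); last first.
  by apply/funext => p /=; rewrite rV_consK.
by rewrite preimage_id product_measure1E// lte_mul_pinfty// ge0_fin_numE.
Qed.

HB.instance Definition _ :=
  Measure_isSigmaFinite.Build _ _ _ lebesgue_step lebesgue_step_sigma_finite.

End lebesgue_step.

(* Lebesgue measure on R^d, as the iterated product of the one on R. *)
Fixpoint lebesgue_rV d : {sigma_finite_measure set 'rV[R]_d -> \bar R} :=
  match d with
  | 0 => \d_(0 : 'rV[R]_0)
  | d'.+1 => lebesgue_step (lebesgue_rV d')
  end.

Lemma lebesgue_rV_box d (a b : 'I_d -> R) : (forall i, a i <= b i) ->
  lebesgue_rV d [set x | forall i, a i <= x 0 i <= b i] =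
  (\prod_(i < d) (b i - a i))%:E.
Proof.
elim: d a b => [|d IH] a b ab /=.
  rewrite big_ord0 diracE mem_set// => -[]//.
rewrite big_ord_recl EFinM -(IH (a \o lift ord0) (b \o lift ord0)) => [|i]; last exact: ab.
rewrite /lebesgue_step /pushforward.
set B : set 'rV[R]_d :=
  [set x | forall i, a (lift ord0 i) <= x 0 i <= b (lift ord0 i)].
have mB : measurable B.
  have -> : B = \bigcap_(i in [set: 'I_d]) (fun x : 'rV[R]_d => x 0 i) @^-1`
      `[a (lift ord0 i), b (lift ord0 i)]%classic.
    apply/seteqP; split=> [t /= qt i _|t /= qt i]; first by rewrite /= in_itv/=.
    by have := qt i Logic.I; rewrite /= in_itv.
  apply: fin_bigcap_measurable => // i _.
  by rewrite -[X in measurable X]setTI; exact: measurable_coord.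
rewrite (_ : _ @^-1` _ = `[a ord0, b ord0]%classic `*` B); last first.
  apply/seteqP; split=> [[t x] /= h|[t x] /= [h0 h] i].
    split=> [|i].
      by have := h ord0; rewrite mxE unlift_none in_itv.
    by have := h (lift ord0 i); rewrite mxE liftK.
  rewrite mxE; case: unliftP => [j ->|->]; first exact: h.
  by rewrite in_itv/= in h0.
rewrite product_measure1E//; congr (_ * _)%E.
apply: (etrans (lebesgue_measure_itv _)); rewrite /= lte_fin.
case: ltgtP (ab ord0) => [h _|//|-> _]; first by rewrite EFinB.
by rewrite subrr.
Qed.

End lebesgue_rV.

(* The norm that the library puts on 'rV is the sup norm. *)
Definition enorm {R : realType} d (x : 'rV[R]_d) : R :=
  Num.sqrt (\sum_(i < d) x 0 i ^+ 2).

(* [U] is meant to be open; as the spaces are finite-dimensional, continuity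
   of the directional derivatives is continuity of the differential. *)
Definition C1_on {R : realType} {V W : normedModType R} (U : set V)
    (f : V -> W) : Prop :=
  forall x, U x -> differentiable f x /\
    forall v : V, {for x, continuous (fun y => 'd f y v)}.

Section cost.
Context {R : realType} (d : nat).
Implicit Types l : \bar R -> \bar R.

(* l maps [0, +oo] to itself; its values at negative reals and at -oo play no
   role. *)
Definition cost l (x y : 'rV[R]_d) : \bar R := l (enorm (x - y))%:E.

Definition profile_range l : Prop := forall r, (0 <= r)%E -> (0 <= l r)%E.

(* The finiteness clause makes the profile a real function on ]0, +oo[; it is
   part of being C^1 there. *)
Definition profile_regular l : Prop :=
  [/\ forall r : R, 0 < r -> l r%:E \is a fin_num,
      forall r s t : R, 0 < r -> 0 < s -> r != s -> 0 < t < 1 ->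
        (l (t * r + (1 - t) * s)%:E < t%:E * l r%:E + (1 - t)%:E * l s%:E)%E,
      forall r s : R, 0 < r -> r < s -> (l s%:E < l r%:E)%E &
      C1_on [set r : R^o | 0 < r] (fun r : R^o => fine (l r%:E) : R^o)].

Definition cost_C1_off_diagonal l : Prop :=
  (forall x y, x != y -> cost l x y \is a fin_num) /\
  C1_on [set p : 'rV[R]_d * 'rV[R]_d | p.1 != p.2]
    (fun p => fine (cost l p.1 p.2) : R^o).

Definition cost_lsc l : Prop :=
  lower_semicontinuous (fun p : 'rV[R]_d * 'rV[R]_d => cost l p.1 p.2).

Definition cost_diagonal l : Prop := forall x, cost l x x = +oo%E.

End cost.

Section measures.
Context {R : realType} (d : nat).
Implicit Types (mu : probability 'rV[R]_d R).

Definition radially_symmetric mu : Prop :=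
  forall Q : 'M[R]_d, Q *m Q^T = 1%:M ->
  forall A : set 'rV[R]_d, measurable A ->
    pushforward mu (fun x : 'rV[R]_d => x *m Q) A = mu A.

Definition has_density mu (rho : 'rV[R]_d -> R) : Prop :=
  [/\ measurable_fun setT rho, forall x, 0 <= rho x &
      forall A : set 'rV[R]_d, measurable A ->
        mu A = (\int[lebesgue_rV d]_(x in A) (rho x)%:E)%E].

Definition msupport mu : set 'rV[R]_d :=
  \bigcap_(C in [set C : set 'rV[R]_d | closed C /\ mu C = 1%E]) C.

(* The product sigma-algebra on R^d x R^d is its Borel sigma-algebra. *)
Definition transport_plan mu
    (gamma : probability ('rV[R]_d * 'rV[R]_d)%type R) : Prop :=
  forall A : set 'rV[R]_d, measurable A ->
    pushforward gamma fst A = mu A /\ pushforward gamma snd A = mu A.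

Definition transport_cost (c : 'rV[R]_d -> 'rV[R]_d -> \bar R)
    (gamma : probability ('rV[R]_d * 'rV[R]_d)%type R) : \bar R :=
  (\int[gamma]_p c p.1 p.2)%E.

Definition unique_minimizer c mu
    (gamma : probability ('rV[R]_d * 'rV[R]_d)%type R) : Prop :=
  transport_plan mu gamma /\
  forall gamma' : probability ('rV[R]_d * 'rV[R]_d)%type R,
    transport_plan mu gamma' ->
    (transport_cost c gamma <= transport_cost c gamma')%E /\
    (transport_cost c gamma' = transport_cost c gamma ->
     forall A, measurable A -> gamma' A = gamma A).

Definition optimal_map c mu (T : 'rV[R]_d -> 'rV[R]_d) : Prop :=
  [/\ measurable_fun setT T,
      forall A : set 'rV[R]_d, measurable A -> pushforward mu T A = mu A &
      exists2 gamma : probability ('rV[R]_d * 'rV[R]_d)%type R,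
        forall A, measurable A ->
          gamma A = pushforward mu (fun x => (x, T x)) A &
        unique_minimizer c mu gamma].

End measures.

(* Main.v *)
Require Import Defs.
From HB Require Import structures.
From mathcomp Require Import all_boot all_order all_algebra.
From mathcomp Require Import ring lra.
From mathcomp Require Import all_classical all_reals all_analysis.
From mathcomp Require Import measurable_realfun lebesgue_integral.
Set Implicit Arguments.
Unset Strict Implicit.
Unset Printing Implicit Defensive.
Import Order.TTheory GRing.Theory Num.Theory.
Import numFieldNormedType.Exports.
Local Open Scope classical_set_scope.
Local Open Scope ring_scope.

(** Since the minimizer is unique, the optimal plan is invariant under applying
one reflection to both x and y.  If tau is a measure-preserving involution,
giving each point w the second coordinate of tau w, on a tau-invariant set,
keeps both marginals; hence the set where such an exchange lowers the cost is
null.  Taking for tau the reflection along v itself yields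
(x . v) (y . v) <= 0 for every v, so that y points opposite to x.  Taking
tau (p, q) = (q, p) followed by the reflection that aligns the directions of
the two first coordinates, strict convexity of l shows that two independent
points of the plan never have |x| < |x'| and |y| < |y'|.  Spheres are null, so
F |x| + F |y| = 1 for the distribution function F of |x|, and |T x| is the
decreasing rearrangement of |x|. *)

(** Each reflection vector v has its own exceptional null set, and there are uncountably many v. The
    exchange is therefore made for rational v only; the other vectors are reached because violating
    the resulting inequality is an open condition on v. The exchange compares integrals by
    subtraction, so it needs a finite optimal cost. This too comes from uniqueness: if the optimal
    cost were infinite, every plan would be a minimizer, although the plans carried by the graphs of
    id and of -id differ. The relation between F |x| and F |y| fixes |y| only up to intervals on
    which F is constant. Almost every radius is the least one of its level, so the least solution is
    the right one. *)

Section generic_measure.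
Context d (X : measurableType d) (R : realType).

Lemma measurable_lt_bool (f g : X -> \bar R) :
  measurable_fun setT f -> measurable_fun setT g ->
  measurable_fun setT (fun x => (f x < g x)%E).
Proof.
move=> mf mg; apply: (@measurable_fun_bool _ _ _ _ true).
have := measurable_lte (@measurableT _ X) mf mg.
rewrite setTI (_ : [set x | _] = (fun x => (f x < g x)%E) @^-1` [set true]) ?setTI//.
Qed.

(** Used with [g] the symmetrized cost of the optimal plan and [f] that of a competitor. *)
Lemma lt_null_of_integral_ge (P : {measure set X -> \bar R}) (f g : X -> \bar R) :
  measurable_fun setT f -> measurable_fun setT g ->
  (forall x, 0 <= f x)%E -> (forall x, f x <= g x)%E ->
  (\int[P]_x g x < +oo)%E -> (\int[P]_x g x <= \int[P]_x f x)%E ->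
  P [set x | (f x < g x)%E] = 0%E.
Proof.
move=> mf mg f0 fg goo gf.
(* The test avoids oo - oo: where [f x < g x], the value [f x] is finite. Elsewhere [f x = g x], so
   [g = f + h] holds everywhere. *)
pose h x := (if (f x < g x)%E then g x - f x else 0)%E.
have mB := measurable_lt_bool mf mg.
have mh : measurable_fun setT h.
  by apply: measurable_fun_ifT => //; exact: emeasurable_funB.
have ffin x : (f x < g x)%E -> f x \is a fin_num.
  by move=> fgx; rewrite ge0_fin_numE// (lt_le_trans fgx)// leey.
have h0 x : (0 <= h x)%E.
  by rewrite /h; case: ifPn => // fgx; rewrite sube_ge0 ?ltW// ffin.
have fhg x : (f x + h x = g x)%E.
  rewrite /h; case: ifPn => [fgx|].
    by rewrite addeC subeK// ffin.
  by rewrite -leNgt adde0 => gfx; apply/eqP; rewrite eq_le fg.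
have /eqP ih0 : (\int[P]_x h x == 0)%E.
  have ffi : (\int[P]_x f x)%E \is a fin_num.
    rewrite ge0_fin_numE ?integral_ge0//; apply: le_lt_trans goo.
    exact: ge0_le_integral.
  have := gf; under eq_integral do rewrite -fhg.
  rewrite ge0_integralD// -[X in (_ <= X)%E]adde0 leeD2lE// => h0'.
  by rewrite eq_le h0' integral_ge0.
have /ae_eq_integral_abs : (\int[P]_x `|h x| = 0)%E.
  by under eq_integral do rewrite gee0_abs//.
move=> /(_ measurableT mh) [N [mN N0 hN]].
apply: (subset_measure0 _ mN _ N0).
  by rewrite -[X in measurable X]setTI; exact: measurable_lte.
move=> x /= fgx; apply: hN => /= /(_ Logic.I).
by rewrite /h fgx => /eqP; rewrite gt_eqF// sube_gt0.
Qed.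

End generic_measure.

(** * Reflections *)

Section dot.
Context {R : realType} (d : nat).
Implicit Types x y v : 'rV[R]_d.

(** As a matrix product, it inherits bilinearity and fits the matrix form of [refl]. *)
Definition dot x y : R := (x *m y^T) 0 0.

Lemma dotE x y : dot x y = \sum_(i < d) x 0 i * y 0 i.
Proof. by rewrite /dot mxE; apply: eq_bigr => i _; rewrite mxE. Qed.

Lemma dotC x y : dot x y = dot y x.
Proof. by rewrite !dotE; apply: eq_bigr => i _; rewrite mulrC. Qed.

Lemma dotDl x y v : dot (x + y) v = dot x v + dot y v.
Proof. by rewrite /dot mulmxDl mxE. Qed.

Lemma dotZl a x v : dot (a *: x) v = a * dot x v.
Proof. by rewrite /dot -scalemxAl mxE. Qed.

Lemma dotNl x v : dot (- x) v = - dot x v.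
Proof. by rewrite /dot mulNmx mxE. Qed.

Lemma dotDr x y v : dot v (x + y) = dot v x + dot v y.
Proof. by rewrite dotC dotDl !(dotC v). Qed.

Lemma dotZr a x v : dot v (a *: x) = a * dot v x.
Proof. by rewrite dotC dotZl (dotC v). Qed.

Lemma dotNr x v : dot v (- x) = - dot v x.
Proof. by rewrite dotC dotNl (dotC v). Qed.

Definition dotE_simp := (dotDl, dotDr, dotNl, dotNr, dotZl, dotZr).

Lemma dot_ge0 x : 0 <= dot x x.
Proof. by rewrite dotE sumr_ge0// => i _; rewrite -expr2 sqr_ge0. Qed.

Lemma dot_eq0 x : (dot x x == 0) = (x == 0).
Proof.
apply/idP/eqP => [|->]; last by rewrite /dot mul0mx mxE.
rewrite dotE psumr_eq0 => [/allP h|i _]; last by rewrite -expr2 sqr_ge0.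
apply/rowP => i; rewrite mxE; apply/eqP.
by have := h i (mem_index_enum i); rewrite -expr2 sqrf_eq0.
Qed.

Lemma enorm_dot x : enorm x = Num.sqrt (dot x x).
Proof. by rewrite /enorm dotE; congr Num.sqrt; apply: eq_bigr => i _;
  rewrite expr2. Qed.

Lemma enorm_ge0 x : 0 <= enorm x.
Proof. exact: sqrtr_ge0. Qed.

Lemma enorm_sqr x : enorm x ^+ 2 = dot x x.
Proof. by rewrite enorm_dot sqr_sqrtr// dot_ge0. Qed.

Lemma enorm_eq0 x : (enorm x == 0) = (x == 0).
Proof. by rewrite enorm_dot sqrtr_eq0 -dot_eq0 eq_le dot_ge0 andbT. Qed.

Lemma enorm0 : enorm (0 : 'rV[R]_d) = 0.
Proof. by apply/eqP; rewrite enorm_eq0. Qed.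

Lemma enorm_gt0 x : (0 < enorm x) = (x != 0).
Proof. by rewrite lt_neqAle enorm_ge0 andbT eq_sym enorm_eq0. Qed.

Lemma enormZ a x : 0 <= a -> enorm (a *: x) = a * enorm x.
Proof.
move=> a0; rewrite !enorm_dot dotZl dotZr mulrA -expr2 sqrtrM ?sqr_ge0//.
by rewrite sqrtr_sqr ger0_norm.
Qed.

(* [refl 0] is the identity, since 2 / 0 = 0. *)
Definition refl v : 'M[R]_d := 1%:M - (2 / dot v v) *: (v^T *m v).

Lemma mul_refl x v : x *m refl v = x - (2 / dot v v * dot x v) *: v.
Proof.
rewrite /refl mulmxBr mulmx1 -scalemxAr mulmxA -scalerA; congr (_ - _ *: _).
by rewrite -mul_scalar_mx [x *m _]mx11_scalar.
Qed.

Lemma refl_dot x y v : dot (x *m refl v) y = dot x (y *m refl v).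
Proof. by rewrite !mul_refl !dotE_simp (dotC v y); ring. Qed.

Lemma reflK v : cancel (mulmx^~ (refl v)) (mulmx^~ (refl v) : 'rV[R]_d -> _).
Proof.
move=> x; rewrite !mul_refl !dotE_simp.
have [v0|v0] := eqVneq (dot v v) 0;
  first by rewrite v0 invr0 !mulr0 !mul0r !scale0r !subr0.
rewrite -addrA -opprD -scalerDl [X in X *: v](_ : _ = 0) ?scale0r ?subr0//.
by field.
Qed.

Lemma refl_orthogonal v : refl v *m (refl v)^T = 1%:M.
Proof.
have -> : (refl v)^T = refl v.
  by rewrite /refl linearB/= linearZ/= trmx1 trmx_mul trmxK.
by apply/row_matrixP => i; rewrite !rowE mulmxA (reflK v) mulmx1.
Qed.

Lemma dot_refl x y v : dot (x *m refl v) (y *m refl v) = dot x y.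
Proof. by rewrite refl_dot reflK. Qed.

Lemma enorm_refl x v : enorm (x *m refl v) = enorm x.
Proof. by rewrite !enorm_dot dot_refl. Qed.

Lemma enorm_refl_swap x y v : enorm (x *m refl v - y) = enorm (x - y *m refl v).
Proof. by rewrite -[LHS](enorm_refl _ v) mulmxBl reflK. Qed.

(** The sign of (x . v) (y . v) decides whether reflecting y moves it away from x or towards x. *)
Lemma enorm_reflB x y v :
  dot (x - y *m refl v) (x - y *m refl v) = dot (x - y) (x - y)
    + 4 / dot v v * (dot x v * dot y v).
Proof.
rewrite !dotDl !dotDr !dotNl !dotNr dot_refl refl_dot !mul_refl !dotE_simp.
by rewrite (dotC y x); ring.
Qed.

Lemma antiparallel_of_dot x y : x != 0 ->
  (forall v, dot x v * dot y v <= 0) -> y = - (enorm y / enorm x) *: x.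
Proof.
move=> x0 h; have X0 : 0 < enorm x by rewrite enorm_gt0.
have [->|y0] := eqVneq y 0; first by rewrite enorm0 mul0r oppr0 scale0r.
have Y0 : 0 < enorm y by rewrite enorm_gt0.
(* For this v the product is |x| |y| (|x| |y| + x . y)^2, so its sign forces equality in the
   Cauchy-Schwarz inequality. *)
have /eqP := h (enorm y *: x + enorm x *: y).
rewrite !dotE_simp (dotC y x) -!enorm_sqr => /eqP hD.
have D0 : enorm x * enorm y + dot x y = 0.
  apply/eqP; rewrite -sqrf_eq0 eq_le sqr_ge0 andbT.
  rewrite -(pmulr_rle0 _ (mulr_gt0 X0 Y0)).
  by apply: le_trans hD; rewrite le_eqVlt; apply/orP; left; apply/eqP; ring.
apply/eqP; rewrite -subr_eq0 -dot_eq0 !dotE_simp (dotC y x) -!enorm_sqr.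
rewrite (_ : dot x y = - (enorm x * enorm y)); last by lra.
by apply/eqP; field; rewrite gt_eqF.
Qed.

(** The mirror orthogonal to the difference of two unit vectors swaps them. If they coincide, the
    difference is 0 and [refl 0] is the identity, as it should be. *)
Lemma refl_direction x y : x != 0 -> y != 0 ->
  y *m refl ((enorm x)^-1 *: x - (enorm y)^-1 *: y) = (enorm y / enorm x) *: x.
Proof.
move=> x0 y0; have X0 : enorm x != 0 by rewrite enorm_eq0.
have Y0 : enorm y != 0 by rewrite enorm_eq0.
set v := _ - _; rewrite mul_refl.
have vE : x = enorm x *: v + (enorm x / enorm y) *: y.
  by rewrite /v scalerBr !scalerA divff// scale1r subrK.
have vv : dot v v = 2 - 2 * dot x y / (enorm x * enorm y).
  rewrite /v !dotE_simp (dotC y x) -!enorm_sqr; field.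
  by apply/andP.
have yv : dot y v = - enorm y / 2 * dot v v.
  rewrite vv /v !dotE_simp (dotC y x) -!enorm_sqr; field.
  by apply/andP.
clearbody v; rewrite yv [X in _ = _ *: X]vE scalerDr !scalerA (_ : enorm y / enorm x * (enorm x / enorm y) = 1).
  rewrite scale1r addrC; congr (_ + _); rewrite -scaleNr.
  have [v0|v0] := eqVneq v 0; first by rewrite v0 !scaler0.
  congr (_ *: v); have := v0; rewrite -dot_eq0 => v0'.
  by field; apply/andP.
by field; apply/andP.
Qed.

End dot.

(** * The exchange argument *)

Section image_measure.
Context d d' (X : measurableType d) (Y : measurableType d') (R : realType).

Lemma exists_image_probability (P : probability X R) (f : X -> Y) :
  measurable_fun setT f ->
  exists Q : probability Y R, forall A, Q A = P (f @^-1` A).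
Proof.
move=> mf; pose fm := isMeasurableFun.Build _ _ _ _ _ mf.
pose F : {mfun X >-> Y} := HB.pack f fm.
by exists (distribution P F).
Qed.

Lemma ge0_integral_image (P : {measure set X -> \bar R})
    (Q : {measure set Y -> \bar R}) (f : X -> Y) (g : Y -> \bar R) :
  measurable_fun setT f -> measurable_fun setT g -> (forall y, 0 <= g y)%E ->
  (forall A, measurable A -> P (f @^-1` A) = Q A) ->
  (\int[Q]_y g y = \int[P]_x g (f x))%E.
Proof.
move=> mf mg g0 PQ.
have := ge0_integral_pushforward mf P measurableT mg (fun y _ => g0 y).
rewrite preimage_setT => <-.
pose fm := isMeasurableFun.Build _ _ _ _ _ mf.
pose F : {mfun X >-> Y} := HB.pack f fm.
by rewrite -[f]/(F : X -> Y); apply: eq_measure_integral => A mA _; rewrite -PQ.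
Qed.

Lemma measurable_preimageT (f : X -> Y) A :
  measurable_fun setT f -> measurable A -> measurable (f @^-1` A).
Proof. by move=> mf mA; rewrite -[X in measurable X]setTI; exact: mf. Qed.

End image_measure.

Section exchange.
Context {R : realType} (d : nat) (c : 'rV[R]_d -> 'rV[R]_d -> \bar R).
Hypothesis c_ge0 : forall x y, (0 <= c x y)%E.
Hypothesis mc : measurable_fun setT (fun p : 'rV[R]_d * 'rV[R]_d => c p.1 p.2).
Variables (mu : probability 'rV[R]_d R)
  (gamma : probability ('rV[R]_d * 'rV[R]_d)%type R).
Hypothesis gamma_opt : unique_minimizer c mu gamma.
Hypothesis gamma_fin : (transport_cost c gamma < +oo)%E.

(* The competitor replaces y(w) by y(tau w) on the bad set B.  Since B is
   invariant under the measure-preserving involution tau, this does not change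
   the second marginal, and twice the new cost is the integral of
   c(x, y tau) + c(x tau, y) over B and c(x, y) + c(x tau, y tau) off B. *)
Lemma exchange_null d' (Om : measurableType d') (P : probability Om R)
    (tau : Om -> Om) (X : Om -> 'rV[R]_d * 'rV[R]_d) :
  measurable_fun setT tau -> involutive tau ->
  (forall A, measurable A -> P (tau @^-1` A) = P A) ->
  measurable_fun setT X ->
  (forall A, measurable A -> P (X @^-1` A) = gamma A) ->
  let bad w := (c (X w).1 (X (tau w)).2 + c (X (tau w)).1 (X w).2 <
    c (X w).1 (X w).2 + c (X (tau w)).1 (X (tau w)).2)%E in
  measurable [set w | bad w] /\ P [set w | bad w] = 0%E.
Proof.
move=> mtau tauK Ptau mX PX bad.
have mX1 : measurable_fun setT (fun w => (X w).1) by exact: measurableT_comp.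
have mX2 : measurable_fun setT (fun w => (X w).2) by exact: measurableT_comp.
have mXt1 : measurable_fun setT (fun w => (X (tau w)).1).
  exact: (measurableT_comp mX1 mtau).
have mXt2 : measurable_fun setT (fun w => (X (tau w)).2).
  exact: (measurableT_comp mX2 mtau).
have mcc (f g : Om -> 'rV[R]_d) : measurable_fun setT f -> measurable_fun setT g ->
    measurable_fun setT (fun w => c (f w) (g w)).
  by move=> mf mg; apply: (measurableT_comp mc (measurable_fun_pair mf mg)).
have mbad : measurable_fun setT bad.
  by apply: measurable_lt_bool; apply: emeasurable_funD; exact: mcc.
have mB : measurable [set w | bad w].
  by have := measurable_preimageT (A := [set true]) mbad; apply.
split=> //.
have badtau w : bad (tau w) = bad w.
  by rewrite /bad tauK addeC [X in (_ < X)%E]addeC.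
pose Phi w := ((X w).1, if bad w then (X (tau w)).2 else (X w).2).
have mPhi : measurable_fun setT Phi.
  by apply: measurable_fun_pair => //; exact: measurable_fun_ifT.
have [Q QE] := exists_image_probability P mPhi.
have [gmu gmin] := gamma_opt.
have planQ : transport_plan mu Q.
  move=> A mA; have [g1 g2] := gmu A mA; split.
    by rewrite -g1 /pushforward QE -PX//; exact: measurable_preimageT.
  rewrite -g2 /pushforward QE -PX; last exact: measurable_preimageT.
  have mA2 : measurable ((fun w => (X w).2) @^-1` A) by exact: measurable_preimageT.
  have mPA : measurable (Phi @^-1` (snd @^-1` A)).
    by do 2 apply: measurable_preimageT => //.
  rewrite (measureDI P mPA mB) [RHS](measureDI P mA2 mB); congr (_ + _)%E.
    by congr (P _); apply/seteqP; split=> w /= [+ /negP/negbTE badw];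
      rewrite /Phi/= badw.
  rewrite -[RHS]Ptau; last exact: measurableI.
  congr (P _); apply/seteqP; split=> w /=; rewrite badtau => -[+ badw];
    by rewrite /Phi/= badw.
have [costQ _] := gmin Q planQ.
have cX : transport_cost c gamma = (\int[P]_w c (X w).1 (X w).2)%E.
  exact: (ge0_integral_image mX mc (fun p => c_ge0 p.1 p.2) PX).
have cPhi : transport_cost c Q = (\int[P]_w c (Phi w).1 (Phi w).2)%E.
  by apply: (ge0_integral_image mPhi mc (fun p => c_ge0 p.1 p.2)) => A mA;
    exact/esym/QE.
have inttau (h : Om -> \bar R) : measurable_fun setT h -> (forall w, 0 <= h w)%E ->
    (\int[P]_w h w = \int[P]_w h (tau w))%E.
  by move=> mh h0; exact: ge0_integral_image.
have mPhi1 : measurable_fun setT (fun w => (Phi w).1) by exact: measurableT_comp.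
have mPhi2 : measurable_fun setT (fun w => (Phi w).2) by exact: measurableT_comp.
(* Exchanging may raise the cost at w while lowering it at tau w. Summing over the orbit makes the
   comparison pointwise: f <= g, strictly so exactly on the bad set. *)
pose f w := (c (Phi w).1 (Phi w).2 + c (Phi (tau w)).1 (Phi (tau w)).2)%E.
pose g w := (c (X w).1 (X w).2 + c (X (tau w)).1 (X (tau w)).2)%E.
have fE w : f w = if bad w then (c (X w).1 (X (tau w)).2 + c (X (tau w)).1 (X w).2)%E
    else g w.
  by rewrite /f /g /Phi/= badtau tauK; case: ifP.
have BE : [set w | bad w] = [set w | (f w < g w)%E].
  by apply/seteqP; split=> w /=; rewrite fE; case: ifPn => // _; rewrite ltxx.
have mcX : measurable_fun setT (fun w => c (X w).1 (X w).2) by exact: mcc.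
have mcXt : measurable_fun setT (fun w => c (X (tau w)).1 (X (tau w)).2) by exact: mcc.
have mcP : measurable_fun setT (fun w => c (Phi w).1 (Phi w).2) by exact: mcc.
have mcPt : measurable_fun setT (fun w => c (Phi (tau w)).1 (Phi (tau w)).2).
  exact: (measurableT_comp mcP mtau).
have intg : (\int[P]_w g w = transport_cost c gamma + transport_cost c gamma)%E.
  by rewrite ge0_integralD// -(inttau _ mcX)// -cX.
have intf : (\int[P]_w f w = transport_cost c Q + transport_cost c Q)%E.
  by rewrite ge0_integralD// -(inttau _ mcP)// -cPhi.
rewrite BE; apply: lt_null_of_integral_ge.
- exact: emeasurable_funD.
- exact: emeasurable_funD.
- by move=> w; rewrite adde_ge0.
- by move=> w; rewrite fE; case: ifPn => // /ltW.
- by rewrite intg lte_add_pinfty.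
- by rewrite intf intg leeD.
Qed.

End exchange.

(** * Measurability of the Euclidean operations *)

Section measurability.
Context {R : realType} (d : nat).

Lemma measurable_dot d' (X : measurableType d') (f g : X -> 'rV[R]_d) :
  measurable_fun setT f -> measurable_fun setT g ->
  measurable_fun setT (fun x => dot (f x) (g x)).
Proof.
move=> mf mg; under eq_fun do rewrite dotE.
apply: measurable_sum => i; apply: measurable_funM.
  exact: (measurableT_comp (measurable_coord i) mf).
exact: (measurableT_comp (measurable_coord i) mg).
Qed.

Lemma measurable_enorm d' (X : measurableType d') (f : X -> 'rV[R]_d) :
  measurable_fun setT f -> measurable_fun setT (fun x => enorm (f x)).
Proof.
move=> mf; under eq_fun do rewrite enorm_dot.
apply: (@measurableT_comp _ _ _ _ _ _ (@Num.sqrt R : R -> R));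
  last exact: measurable_dot.
by apply: continuous_measurable_fun; exact: sqrt_continuous.
Qed.

Lemma measurable_rVB d' (X : measurableType d') (f g : X -> 'rV[R]_d) :
  measurable_fun setT f -> measurable_fun setT g ->
  measurable_fun setT (fun x => f x - g x).
Proof.
move=> mf mg; apply: measurable_fun_rV => i; under eq_fun do rewrite !mxE.
apply: measurable_funB.
  exact: (measurableT_comp (measurable_coord i) mf).
exact: (measurableT_comp (measurable_coord i) mg).
Qed.

Lemma measurable_mulmx (M : 'M[R]_d) :
  measurable_fun setT (fun x : 'rV[R]_d => x *m M).
Proof.
apply: measurable_fun_rV => i; under eq_fun do rewrite mxE.
apply: measurable_sum => j; apply: measurable_funM => //.
exact: measurable_coord.
Qed.

End measurability.

(** * Spheres have measure zero *)

Section sphere.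
Context {R : realType}.

Lemma measurable_level d' (X : measurableType d') (f : X -> R) r :
  measurable_fun setT f -> measurable [set x | f x = r].
Proof.
by move=> mf; apply: (measurable_preimageT (f := f) (A := [set r])).
Qed.

Lemma dot_rV_cons d (t : R) (v : 'rV[R]_d) :
  dot (rV_cons (t, v)) (rV_cons (t, v)) = t ^+ 2 + dot v v.
Proof.
rewrite !dotE big_ord_recl /rV_cons !mxE unlift_none/= expr2; congr (_ + _).
by apply: eq_bigr => i _; rewrite !mxE liftK.
Qed.

Lemma lebesgue_rV_sphere d (r : R) : (0 < d)%N ->
  lebesgue_rV d [set x | enorm x = r] = 0%E.
Proof.
case: d => // d _ /=; rewrite /lebesgue_step /pushforward.
set S := _ @^-1` _.
have mS : measurable S.
  apply: measurable_preimageT => //; apply: measurable_level.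
  exact: measurable_enorm.
(* The order of integration is switched so that the sections are lines along the first axis, which
   meet the sphere in at most two points. *)
rewrite (product_measure_unique (m' := @lebesgue_measure R \x^ lebesgue_rV d)%E)//;
  last first.
  by move=> A B mA mB; exact: product_measure2E.
apply: integral0_eq => v _ /=.
have fS : finite_set (ysection S v).
  apply: (@sub_finite_set _ _ [set Num.sqrt (r ^+ 2 - dot v v);
    - Num.sqrt (r ^+ 2 - dot v v)]).
    move=> t; rewrite /ysection/= inE /S/= => h.
    have tE : t ^+ 2 = r ^+ 2 - dot v v by rewrite -h enorm_sqr dot_rV_cons addrK.
    rewrite -tE sqrtr_sqr.
    by case: (ger0P t) => _; [left|right; rewrite opprK].
  exact: finite_set2.
apply: countable_lebesgue_measure0; exact: finite_set_countable.
Qed.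

Lemma has_density_sphere_null d (mu : probability 'rV[R]_d R) rho (r : R) :
  (0 < d)%N -> has_density mu rho -> mu [set x | enorm x = r] = 0%E.
Proof.
move=> d0 [mrho rho0 muE].
have mS : measurable [set x : 'rV[R]_d | enorm x = r].
  by apply: measurable_level; exact: measurable_enorm.
rewrite muE//; apply: null_set_integral => //.
  by apply/measurable_EFinP; exact: measurable_funTS.
exact: lebesgue_rV_sphere.
Qed.

End sphere.

(** * The optimal plan *)

Section cost_properties.
Context {R : realType} (d : nat) (l : \bar R -> \bar R).
Hypothesis l_range : profile_range l.
Hypothesis l_reg : profile_regular l.
Hypothesis l_diag : cost_diagonal d l.

Lemma cost_ge0 (x y : 'rV[R]_d) : (0 <= cost l x y)%E.
Proof. by apply: l_range; rewrite lee_fin enorm_ge0. Qed.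

Lemma cost_refl (x y v : 'rV[R]_d) :
  cost l (x *m refl v) (y *m refl v) = cost l x y.
Proof. by rewrite /cost -mulmxBl enorm_refl. Qed.

Lemma cost_refl_swap (x y v : 'rV[R]_d) :
  cost l (x *m refl v) y = cost l x (y *m refl v).
Proof. by rewrite /cost enorm_refl_swap. Qed.

Lemma profile0 : l 0%:E = +oo%E.
Proof. by have := l_diag 0; rewrite /cost subrr enorm0. Qed.

Lemma profile_continuous (r : R) : 0 < r ->
  {for r, continuous (fun s : R => fine (l s%:E))}.
Proof.
have [_ _ _ C1] := l_reg.
by move=> r0; have [/differentiable_continuous] := C1 r r0.
Qed.

Lemma measurable_cost :
  measurable_fun setT (fun p : 'rV[R]_d * 'rV[R]_d => cost l p.1 p.2).
Proof.
have [lfin _ _ _] := l_reg.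
(* Nothing is known about [l] at negative reals; [prof] agrees with it at every norm and is
   measurable on the whole line. *)
pose prof (r : R) : \bar R := if 0 < r then (fine (l r%:E))%:E else +oo%E.
have -> : (fun p : 'rV[R]_d * 'rV[R]_d => cost l p.1 p.2) =
    (fun p => prof (enorm (p.1 - p.2))).
  apply/funext => p; rewrite /prof enorm_gt0 /cost; case: eqVneq => [->|h].
    by rewrite enorm0 profile0.
  by rewrite fineK// lfin// enorm_gt0.
apply: (@measurableT_comp _ _ _ _ _ _ prof); last first.
  by apply: measurable_enorm; exact: measurable_rVB.
have pos_itv : [set: R] `&` (fun r : R => 0 < r) @^-1` [set true] = `]0, +oo[%classic.
  by rewrite setTI; apply/seteqP; split=> r /=; rewrite in_itv/= andbT.
apply: measurable_fun_if => //.
- by apply: measurable_fun_ltr.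
- rewrite pos_itv; apply/measurable_EFinP.
  apply: open_continuous_measurable_fun; first exact: interval_open.
  by move=> r; rewrite inE/= in_itv/= andbT => /profile_continuous.
Qed.

Lemma profile_lt (r s : R) : 0 <= r -> r < s -> (l s%:E < l r%:E)%E.
Proof.
have [lfin _ ldec _] := l_reg.
rewrite le_eqVlt => /orP[/eqP<- s0|r0]; last exact: ldec.
by rewrite profile0 ltey_eq lfin.
Qed.

(* [r + s'] and [r' + s] lie strictly between [r + s] and [r' + s'], and
   the two pairs have the same sum. *)
Lemma profile_exchange (r s r' s' : R) : 0 <= r -> r < r' -> 0 <= s -> s < s' ->
  (l (r + s')%:E + l (r' + s)%:E < l (r + s)%:E + l (r' + s')%:E)%E.
Proof.
move=> r0 rr' s0 ss'; have [lfin lconv _ _] := l_reg.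
have f1 : l (r + s')%:E \is a fin_num by apply: lfin; lra.
have f2 : l (r' + s)%:E \is a fin_num by apply: lfin; lra.
have f3 : l (r' + s')%:E \is a fin_num by apply: lfin; lra.
have [rs0|rs0] := leP (r + s) 0.
  have -> : r + s = 0 by lra.
  rewrite profile0 addye; last by rewrite -ltNye ltNye_eq f3.
  by rewrite ltey_eq fin_numD f1 f2.
have f4 : l (r + s)%:E \is a fin_num by apply: lfin.
pose D := (r' + s') - (r + s).
have D0 : 0 < D by rewrite /D; lra.
have D0' : D != 0 by rewrite gt_eqF.
pose t := (s' - s) / D.
have t0 : 0 < t by apply: divr_gt0 => //; lra.
have t1 : t < 1 by rewrite ltr_pdivrMr// mul1r /D; lra.
have tD : t * D = s' - s by rewrite /t divfK.
have h1 : t * (r' + s') + (1 - t) * (r + s) = r + s'.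
  by have := tD; rewrite /D; lra.
have h2 : (1 - t) * (r' + s') + (1 - (1 - t)) * (r + s) = r' + s.
  by have := tD; rewrite /D; lra.
have ne : r' + s' != r + s by rewrite gt_eqF//; lra.
have p0 : 0 < r' + s' by lra.
have := lconv _ _ t p0 rs0 ne; rewrite t0 t1 h1 => /(_ isT).
have := lconv _ _ (1 - t) p0 rs0 ne.
rewrite subr_gt0 t1 h2 ltrBlDr ltrDl t0 => /(_ isT).
rewrite -(fineK f1) -(fineK f2) -(fineK f3) -(fineK f4).
rewrite -!EFinM -!EFinD !lte_fin; lra.
Qed.

End cost_properties.

Lemma exists_rat_approx {R : realType} d (v : 'rV[R]_d) (U : set 'rV[R]_d) :
  nbhs v U -> exists w : 'rV[rat]_d, U (map_mx ratr w).
Proof.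
move=> /nbhs_ballP[e /= e0 eU].
have /choice[c cP] : forall i : 'I_d, exists c : rat, v 0 i - e < ratr c < v 0 i + e.
  move=> i; have : v 0 i - e < v 0 i + e by lra.
  by move/rat_in_itvoo => [c]; rewrite in_itv/= => ?; exists c.
exists (\row_i c i); apply: eU; split=> // i j.
rewrite !mxE ord1 /ball/= ltr_norml.
by have /andP[] := cP j; lra.
Qed.

Lemma continuous_dot {R : realType} d (T : topologicalType) (f g : T -> 'rV[R]_d) :
  continuous f -> continuous g -> continuous (fun t => dot (f t) (g t)).
Proof.
move=> cf cg; under eq_fun do rewrite dotE.
apply: continuous_big; first exact: add_continuous.
move=> i _ t; apply: (@continuousM R _ (fun t => f t 0 i) (fun t => g t 0 i)).
  by apply: (@continuous_comp _ _ _ f (fun v : 'rV[R]_d => v 0 i));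
    [exact: cf|exact: coord_continuous].
by apply: (@continuous_comp _ _ _ g (fun v : 'rV[R]_d => v 0 i));
  [exact: cg|exact: coord_continuous].
Qed.

Lemma negligible_countable d (X : measurableType d) (R : realType)
    (P : {measure set X -> \bar R}) (I : countType) (N : I -> set X) :
  (forall i, P.-negligible (N i)) -> P.-negligible (\bigcup_i N i).
Proof.
move=> hN; pose F n : set X := if unpickle n is Some i then N i else set0.
have : P.-negligible (\bigcup_n F n).
  apply: negligible_bigcup => n; rewrite /F; case: unpickle => [i|]; first exact: hN.
  exact: negligible_set0.
apply: negligibleS => x [i _ Nx]; exists (pickle i) => //.
by rewrite /F pickleK.
Qed.

Section optimal_plan.
Context {R : realType} (d : nat) (l : \bar R -> \bar R).
Hypothesis l_range : profile_range l.
Hypothesis l_reg : profile_regular l.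
Hypothesis l_diag : cost_diagonal d l.
Variables (mu : probability 'rV[R]_d R)
  (gamma : probability ('rV[R]_d * 'rV[R]_d)%type R).
Hypothesis mu_radial : radially_symmetric mu.
Hypothesis sphere_null : forall r, mu [set x | enorm x = r] = 0%E.
Hypothesis gamma_opt : unique_minimizer (cost l) mu gamma.

Let mc := measurable_cost l_reg l_diag.
Let c0 (p : 'rV[R]_d * 'rV[R]_d) := cost_ge0 l_range p.1 p.2.

(** With infinite cost, the plans given by M = 1 and M = -1 would both equal [gamma], yet the first
    gives the diagonal mass 1 and the second the mass of the origin, which is 0. *)
Lemma transport_cost_fin : (transport_cost (cost l) gamma < +oo)%E.
Proof.
rewrite ltey; apply/eqP => coo; have [gmu gmin] := gamma_opt.
have graph_eq (M : 'M[R]_d) : M *m M^T = 1%:M ->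
    mu [set x | enorm (x - x *m M) = 0] = gamma [set p | enorm (p.1 - p.2) = 0].
  move=> Mo; have mM : measurable_fun setT (fun x : 'rV[R]_d => (x, x *m M)).
    by apply: measurable_fun_pair => //; exact: measurable_mulmx.
  have [Q QE] := exists_image_probability mu mM.
  have planQ : transport_plan mu Q.
    by move=> A mA; rewrite /pushforward !QE; split => //; exact: mu_radial.
  have [le_cost eq_cost] := gmin Q planQ.
  rewrite -(eq_cost _ [set p | enorm (p.1 - p.2) = 0]) ?QE//.
    by apply/eqP; rewrite eq_le le_cost andbT coo leey.
  by apply: measurable_level; apply: measurable_enorm; exact: measurable_rVB.
have := graph_eq 1%:M; rewrite trmx1 mulmx1 => /(_ erefl).
have <- := graph_eq (- 1%:M);
  last by rewrite linearN/= trmx1 mulmxN mulNmx mulmx1 opprK.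
rewrite [X in mu X = _](_ : _ = setT); last first.
  by apply/seteqP; split=> x //= _; rewrite mulmx1 subrr enorm0.
rewrite [X in _ = mu X](_ : _ = [set x | enorm x = 0]).
  by rewrite sphere_null probability_setT => /eqP; rewrite onee_eq0.
apply/seteqP; split=> x /=; rewrite mulmxN mulmx1 opprK -mulr2n -scaler_nat enormZ//.
  by move=> /eqP; rewrite mulf_eq0 pnatr_eq0/= => /eqP.
by move=> ->; rewrite mulr0.
Qed.

Definition refl_pair v (p : 'rV[R]_d * 'rV[R]_d) := (p.1 *m refl v, p.2 *m refl v).

Lemma measurable_refl_pair v : measurable_fun setT (refl_pair v).
Proof.
by apply: measurable_fun_pair;
  exact: (measurableT_comp (measurable_mulmx (refl v))).
Qed.

Lemma refl_pairK v : involutive (refl_pair v).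
Proof. by case=> x y; rewrite /refl_pair/= !reflK. Qed.

Lemma gamma_refl v A : measurable A -> gamma (refl_pair v @^-1` A) = gamma A.
Proof.
move=> mA; have [gmu gmin] := gamma_opt.
have mt := measurable_refl_pair v.
have [Q QE] := exists_image_probability gamma mt.
have planQ : transport_plan mu Q.
  move=> B mB; rewrite /pushforward !QE -(mu_radial (refl_orthogonal v) mB).
  have [g1 g2] := gmu _ (measurable_preimageT (measurable_mulmx (refl v)) mB).
  by split; [exact: g1|exact: g2].
have [_ eq_cost] := gmin Q planQ.
rewrite -QE; apply: eq_cost => //.
rewrite /transport_cost (ge0_integral_image mt mc c0 (fun A _ => esym (QE A))).
by apply: eq_integral => p _; rewrite /refl_pair/= cost_refl.
Qed.

(** Exchanging (x, y) with its own mirror image replaces twice c(x, y) by twice c(x, R y).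
    Optimality and the strict decrease of [l] give |x - R y| <= |x - y| almost everywhere, and
    [enorm_reflB] turns this into the sign condition. *)
Lemma gamma_polarized v : exists2 N, measurable N /\ gamma N = 0%E &
  forall p, ~ N p -> dot p.1 v * dot p.2 v <= 0.
Proof.
have [mB B0] := exchange_null (cost_ge0 l_range) mc gamma_opt transport_cost_fin
  (measurable_refl_pair v) (refl_pairK v) (@gamma_refl v) (@measurable_id _ _ _)
  (fun _ _ => erefl).
exists [set w | (cost l w.1 (refl_pair v w).2 + cost l (refl_pair v w).1 w.2 <
    cost l w.1 w.2 + cost l (refl_pair v w).1 (refl_pair v w).2)%E] => // -[x y] /= h.
rewrite leNgt; apply/negP => xy0; apply: h.
have v0 : 0 < dot v v.
  rewrite lt_neqAle dot_ge0 andbT eq_sym dot_eq0; apply: contraTneq xy0 => ->.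
  by rewrite -[X in dot x X](scale0r (0 : 'rV[R]_d)) dotZr !mul0r ltxx.
rewrite cost_refl cost_refl_swap.
have lt_c : (cost l x (y *m refl v) < cost l x y)%E.
  rewrite /cost; apply: (profile_lt l_reg l_diag); first exact: enorm_ge0.
  rewrite !enorm_dot ltr_sqrt.
    by rewrite enorm_reflB ltrDl mulr_gt0// divr_gt0.
  by rewrite enorm_reflB ltr_wpDl ?dot_ge0// mulr_gt0// divr_gt0.
by apply: lteD.
Qed.

(** Off the union of the null sets of the rational v, the sign condition extends to all real v: a
    strictly positive product would persist at a nearby rational vector. *)
Lemma gamma_antiparallel : {ae gamma, forall p, p.1 != 0 /\
  p.2 = - (enorm p.2 / enorm p.1) *: p.1}.
Proof.
have /choice[N NP] (w : 'rV[rat]_d) : exists N, (measurable N /\ gamma N = 0%E) /\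
    forall p, ~ N p -> dot p.1 (map_mx ratr w) * dot p.2 (map_mx ratr w) <= 0.
  by have [N] := gamma_polarized (map_mx ratr w); exists N.
have N0 : gamma.-negligible [set p | p.1 = 0].
  have [gmu _] := gamma_opt.
  have -> : [set p : 'rV[R]_d * 'rV[R]_d | p.1 = 0] = fst @^-1` [set x | enorm x = 0].
    by apply/seteqP; split=> p /= => [->|/eqP]; rewrite ?enorm0// enorm_eq0 => /eqP.
  have mS : measurable [set x : 'rV[R]_d | enorm x = 0].
    by apply: measurable_level; exact: measurable_enorm.
  apply/negligibleP; first exact: measurable_preimageT.
  by have [h _] := gmu _ mS; rewrite -(sphere_null 0) -h.
apply: negligibleS (negligibleU N0 (negligible_countable (fun w =>
  proj2 (negligibleP _ (NP w).1.1) (NP w).1.2))).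
move=> [x y] /= /not_andP[/negP/negPn/eqP->|h]; first by left.
have [->|x0] := eqVneq x 0; [by left|right].
apply: contrapT => hN; apply: h; apply: antiparallel_of_dot => // v.
rewrite leNgt; apply/negP => hv.
have cU : continuous (fun v => dot x v * dot y v).
  by move=> w; apply: (@continuousM R _ (dot x) (dot y));
    apply: continuous_dot => ?; [exact: cst_continuous|exact: cvg_id|
                                 exact: cst_continuous|exact: cvg_id].
have [w] := exists_rat_approx (cvgr_gt _ (cU v) _ hv).
rewrite /= ltNge => /negP; apply; apply: ((NP w).2 (x, y)) => Nw.
by apply: hN; exists w.
Qed.

End optimal_plan.

Lemma negligible_setX d1 d2 (X : measurableType d1) (Y : measurableType d2)
    (R : realType) (P : probability X R) (Q : probability Y R) (A : set X) (B : set Y) :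
  P.-negligible A -> Q.-negligible B ->
  (P \x Q)%E.-negligible [set p | A p.1 \/ B p.2].
Proof.
move=> [M [mM M0 AM]] [N [mN N0 BN]].
apply: (@negligibleS _ _ _ _ (M `*` setT `|` setT `*` N)).
  by move=> p [/AM|/BN]; [left|right].
apply: negligibleU; apply/negligibleP; try exact: measurableX.
  by rewrite [LHS]product_measure1E// [X in (X * _)%E]M0 mul0e.
by rewrite [LHS]product_measure1E// [X in (_ * X)%E]N0 mule0.
Qed.

Lemma antiparallel_dist {R : realType} d (x y : 'rV[R]_d) : x != 0 ->
  y = - (enorm y / enorm x) *: x -> enorm (x - y) = enorm x + enorm y.
Proof.
move=> x0 yE; have X0 : 0 < enorm x by rewrite enorm_gt0.
rewrite [X in enorm (x - X)]yE -scaleNr opprK -{1}[x]scale1r -scalerDl enormZ.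
  by rewrite mulrDl mul1r divfK// gt_eqF.
by rewrite addr_ge0 ?divr_ge0 ?enorm_ge0.
Qed.

(** * The radii of two independent points of the plan are oppositely ordered *)

Section monotone.
Context {R : realType} (d : nat) (l : \bar R -> \bar R).
Hypothesis l_range : profile_range l.
Hypothesis l_reg : profile_regular l.
Hypothesis l_diag : cost_diagonal d l.
Variables (mu : probability 'rV[R]_d R)
  (gamma : probability ('rV[R]_d * 'rV[R]_d)%type R).
Hypothesis mu_radial : radially_symmetric mu.
Hypothesis sphere_null : forall r, mu [set x | enorm x = r] = 0%E.
Hypothesis gamma_opt : unique_minimizer (cost l) mu gamma.

Let E2 : Type := ('rV[R]_d * 'rV[R]_d)%type.

Lemma gamma_exchange v : exists N, (measurable N /\ (gamma \x gamma)%E N = 0%E) /\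
  forall p q : 'rV[R]_d * 'rV[R]_d, ~ N (p, q) ->
  (cost l p.1 p.2 + cost l q.1 q.2 <=
   cost l p.1 (q.2 *m refl v) + cost l q.1 (p.2 *m refl v))%E.
Proof.
(* Reflecting both components, not only one, keeps [tau] an involution; it preserves the product
   because [gamma] is reflection invariant. *)
pose tau (w : E2 * E2) : E2 * E2 := (refl_pair v w.2, refl_pair v w.1).
have mtau : measurable_fun setT tau.
  by apply: measurable_fun_pair; exact: (measurableT_comp (measurable_refl_pair v)).
have tauK : involutive tau by case=> p q; rewrite /tau/= !refl_pairK.
have gammatau A : measurable A -> (gamma \x gamma)%E (tau @^-1` A)
  = (gamma \x gamma)%E A.
  move=> mA; have [Q QE] := exists_image_probability (gamma \x gamma)%E mtau.
  rewrite -QE; apply/esym/product_measure_unique => // B C mB mC.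
  rewrite [LHS]QE (_ : _ @^-1` _ = (refl_pair v @^-1` C) `*` (refl_pair v @^-1` B));
    last first.
    by apply/seteqP; split=> -[p q] /= [].
  have mrB := measurable_preimageT (measurable_refl_pair v) mB.
  have mrC := measurable_preimageT (measurable_refl_pair v) mC.
  rewrite [LHS]product_measure1E// [LHS]muleC; congr (_ * _)%E;
    exact: (gamma_refl l_range l_reg l_diag mu_radial gamma_opt).
have gammafst (A : set E2) : measurable A -> (gamma \x gamma)%E (fst @^-1` A) = gamma A.
  move=> mA; rewrite (_ : _ @^-1` _ = A `*` setT); last first.
    by apply/seteqP; split=> -[p q] //= [].
  by rewrite [LHS]product_measure1E// [X in (_ * X)%E](@probability_setT _ _ _ gamma)
    mule1.
have [mB B0] := exchange_null (cost_ge0 l_range) (measurable_cost l_reg l_diag)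
  gamma_opt
  (transport_cost_fin mu_radial sphere_null gamma_opt)
  mtau tauK gammatau measurable_fst gammafst.
eexists; split; first exact: (conj mB B0).
move=> p q /= /negP; rewrite -leNgt /refl_pair/=.
by rewrite cost_refl [X in (_ <= _ + X)%E -> _]cost_refl_swap.
Qed.

(** Once the mirror along [v0] has put both pairs on one line, every distance involved is a sum of
    two radii, and [profile_exchange] contradicts [gamma_exchange]. *)
Lemma gamma_antitone : (gamma \x gamma)%E.-negligible
  [set w | enorm w.1.1 < enorm w.2.1 /\ enorm w.1.2 < enorm w.2.2].
Proof.
have /choice[N NP] (w : 'rV[rat]_d) := gamma_exchange (map_mx ratr w).
have ae_g := gamma_antiparallel l_range l_reg l_diag mu_radial sphere_null gamma_opt.
apply: negligibleS (negligibleU (negligible_setX ae_g ae_g)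
  (negligible_countable (fun w => proj2 (negligibleP _ (NP w).1.1) (NP w).1.2))).
move=> [p q] /= [ltx lty].
apply: contrapT => /not_orP[/not_orP[/contrapT[x0 yE] /contrapT[x'0 y'E]] hN].
have {hN}NP' w := (NP w).2 p q (fun h => hN (ex_intro2 _ _ w Logic.I h)).
move: p q => [x y] [x' y'] /= in ltx lty x0 yE x'0 y'E NP' *.
have X0 : 0 < enorm x by rewrite enorm_gt0.
have X'0 : 0 < enorm x' by rewrite enorm_gt0.
have Y0 := enorm_ge0 y; have Y'0 := enorm_ge0 y'.
have [lfin _ _ _] := l_reg.
pose v0 := (enorm x)^-1 *: x - (enorm x')^-1 *: x'.
have x'v0 : x' *m refl v0 = (enorm x' / enorm x) *: x by exact: refl_direction.
have d1 : enorm (x - y' *m refl v0) = enorm x + enorm y'.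
  have y'v0 : y' *m refl v0 = - (enorm (y' *m refl v0) / enorm x) *: x.
    rewrite enorm_refl {1}y'E -scalemxAl x'v0 scalerA; congr (_ *: _).
    by field; rewrite !gt_eqF.
  by rewrite (antiparallel_dist x0 y'v0) enorm_refl.
have d2 : enorm (x' - y *m refl v0) = enorm x' + enorm y.
  rewrite -enorm_refl_swap x'v0; set z := _ *: x.
  have zE : enorm z = enorm x'.
    by rewrite enormZ ?divfK ?gt_eqF// divr_ge0// ltW.
  rewrite -zE; apply: antiparallel_dist; first by rewrite -enorm_gt0 zE.
  rewrite zE {1}yE /z scalerA; congr (_ *: _).
  by field; rewrite !gt_eqF.
have := profile_exchange l_reg l_diag (enorm_ge0 x) ltx Y0 lty.
rewrite -d1 -d2 -(antiparallel_dist x0 yE) -(antiparallel_dist x'0 y'E) => lt0.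
have [v00|v0N0] := eqVneq v0 0.
  have := NP' 0; rewrite map_mx0 -v00 leNgt => /negP; apply; exact: lt0.
have contPhi a b : {for v0, continuous (fun v => enorm (a - b *m refl v))}.
  have -> : (fun v => enorm (a - b *m refl v)) = (fun v => Num.sqrt (dot (a - b)
    (a - b) +
    4 / dot v v * (dot a v * dot b v))).
    by apply/funext => v; rewrite enorm_dot enorm_reflB.
  apply: (@continuous_comp _ _ _ (fun v : 'rV[R]_d => dot (a - b) (a - b) +
    4 / dot v v * (dot a v * dot b v)) Num.sqrt); last exact: sqrt_continuous.
  apply: (@continuousD R R^o _ (fun=> _)); first exact: cst_continuous.
  apply: (@continuousM R _ (fun v : 'rV[R]_d => 4 / dot v v)).
    apply: (@continuousM R _ (fun=> 4)); first exact: cst_continuous.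
    apply: (@continuousV R _ (fun v : 'rV[R]_d => dot v v)); first by rewrite dot_eq0.
    by apply: continuous_dot => ?; exact: cvg_id.
  apply: (@continuousM R _ (dot a) (dot b));
    apply: continuous_dot => ?; by [exact: cst_continuous|exact: cvg_id].
pose F (a b : 'rV[R]_d) v := fine (l (enorm (a - b *m refl v))%:E).
have contF a b : 0 < enorm (a - b *m refl v0) -> {for v0, continuous (F a b)}.
  move=> ab0; apply: (@continuous_comp _ _ _ (fun v => enorm (a - b *m refl v))
    (fun r => fine (l r%:E))); [exact: contPhi|exact: profile_continuous].
have p1 : 0 < enorm (x - y' *m refl v0) by rewrite d1 ltr_pwDl.
have p2 : 0 < enorm (x' - y *m refl v0) by rewrite d2 ltr_pwDl.
have f3 : l (enorm (x - y))%:E \is a fin_num.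
  by rewrite lfin// (antiparallel_dist x0 yE) ltr_pwDl.
have f4 : l (enorm (x' - y'))%:E \is a fin_num.
  by rewrite lfin// (antiparallel_dist x'0 y'E) ltr_pwDl.
have {}lt0 : F x y' v0 + F x' y v0 < fine (l (enorm (x - y))%:E)
  + fine (l (enorm (x' - y'))%:E).
  by rewrite -lte_fin !EFinD /F !fineK// lfin.
have contFF : {for v0, continuous (fun v => F x y' v + F x' y v)}.
  by apply: (@continuousD R R^o _ (F x y') (F x' y)); exact: contF.
(* Besides the strict inequality, positivity of both distances is kept at [w], so that the costs
   there are finite and [fine] loses nothing. *)
have [w [/= w1 [/= w2]]] := exists_rat_approx (filterI (cvgr_gt _ (contPhi x y') _ p1)
  (filterI (cvgr_gt _ (contPhi x' y) _ p2) (cvgr_lt _ contFF _ lt0))).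
rewrite /= -lte_fin !EFinD /F !fineK ?f3 ?f4 ?lfin// ltNge => /negP; apply.
exact: NP'.
Qed.

End monotone.

Lemma ae_section_null d1 d2 (X : measurableType d1) (Y : measurableType d2)
    (R : realType) (P : probability X R) (Q : probability Y R) (A : set (X * Y)) :
  measurable A -> (P \x Q)%E A = 0%E ->
  {ae P, forall x, Q (xsection A x) = 0%E} /\ {ae Q, forall y, P (ysection A y) = 0%E}.
Proof.
move=> mA A0; split.
  have mf : measurable_fun setT (fun x => Q (xsection A x))
    by exact: measurable_fun_xsection.
  have /(ae_eq_integral_abs _ measurableT mf) : (\int[P]_x `|Q (xsection A x)| = 0)%E.
    by under eq_integral do rewrite gee0_abs//; rewrite -[RHS]A0.
  by apply: filterS => x /(_ Logic.I).
have mf : measurable_fun setT (fun y => P (ysection A y))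
  by exact: measurable_fun_ysection.
have /(ae_eq_integral_abs _ measurableT mf) : (\int[Q]_y `|P (ysection A y)| = 0)%E.
  under eq_integral do rewrite gee0_abs//.
  rewrite -[RHS]A0; apply/esym.
  rewrite (product_measure_unique (m' := (P \x^ Q)%E))// => B C mB mC.
  exact: product_measure2E.
by apply: filterS => x /(_ Logic.I).
Qed.

Lemma lt_measure_bigcup d (X : measurableType d) (R : realType)
    (P : probability X R) (U : (set X)^nat) (a : \bar R) :
  (forall n, measurable (U n)) -> nondecreasing_seq U ->
  (a < P (\bigcup_n U n))%E -> exists n, (a < P (U n))%E.
Proof.
move=> mU ndU aU; apply: contrapT => /forallNP h.
have cvgU := nondecreasing_cvg_mu (mu := P) mU (bigcupT_measurable _ mU) ndU.
have : (P (\bigcup_n U n) <= a)%E.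
  apply: (cvge_to_le cvgU).
  by apply: nearW => n /=; rewrite leNgt; apply/negP/h.
by rewrite leNgt aU.
Qed.

(** * The radial distribution function *)

Section radial_cdf.
Context {R : realType} (d : nat) (mu : probability 'rV[R]_d R).
Hypothesis sphere_null : forall r, mu [set x | enorm x = r] = 0%E.

Definition radial_cdf (r : R) : R := fine (mu [set x | enorm x <= r]).
Local Notation F := radial_cdf.

Lemma measurable_enorm_rel (r : R) :
  [/\ measurable [set x : 'rV[R]_d | enorm x <= r],
      measurable [set x : 'rV[R]_d | enorm x < r],
      measurable [set x : 'rV[R]_d | r <= enorm x] &
      measurable [set x : 'rV[R]_d | r < enorm x]].
Proof.
have me : measurable_fun setT (@enorm R d) by exact: measurable_enorm.
split.
- by apply: (measurable_preimageT (A := `]-oo, r]%classic) me).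
- by apply: (measurable_preimageT (A := `]-oo, r[%classic) me).
- rewrite (_ : mkset _ = @enorm R d @^-1` `[r, +oo[%classic);
    first exact: measurable_preimageT.
  by apply/seteqP; split=> x /=; rewrite in_itv/= andbT.
- rewrite (_ : mkset _ = @enorm R d @^-1` `]r, +oo[%classic);
    first exact: measurable_preimageT.
  by apply/seteqP; split=> x /=; rewrite in_itv/= andbT.
Qed.

Lemma mu_le r : mu [set x | enorm x <= r] = (F r)%:E.
Proof. by rewrite fineK// fin_num_measure//; have [] := measurable_enorm_rel r. Qed.

Lemma mu_lt r : mu [set x | enorm x < r] = (F r)%:E.
Proof.
have [m1 m2 m3 m4] := measurable_enorm_rel r.
have mS : measurable [set x : 'rV[R]_d | enorm x = r].
  by apply: measurable_level; exact: measurable_enorm.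
rewrite -mu_le (_ : [set x | enorm x <= r] =
    [set x | enorm x < r] `|` [set x | enorm x = r]); last first.
  apply/seteqP; split=> x /=; first by rewrite le_eqVlt => /orP[/eqP|]; [right|left].
  by case=> [/ltW|->].
apply: esym; apply: measureU0; [exact: m2|exact: mS|exact: sphere_null].
Qed.

Lemma mu_gt r : mu [set x | r < enorm x] = (1 - F r)%:E.
Proof.
have [m1 m2 m3 m4] := measurable_enorm_rel r.
rewrite EFinB -mu_le -probability_setC//; congr (mu _).
by apply/seteqP; split=> x /=; rewrite ltNge => /negP.
Qed.

Lemma mu_ge r : mu [set x | r <= enorm x] = (1 - F r)%:E.
Proof.
have [m1 m2 m3 m4] := measurable_enorm_rel r.
rewrite EFinB -mu_lt -probability_setC//; congr (mu _).
by apply/seteqP; split=> x /=; rewrite leNgt => /negP.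
Qed.

Lemma radial_cdf_le r s : r <= s -> F r <= F s.
Proof.
have [m1 m2 m3 m4] := measurable_enorm_rel r.
have [m1' m2' m3' m4'] := measurable_enorm_rel s.
move=> rs; rewrite -lee_fin -!mu_le; apply: le_measure; rewrite ?inE//.
by move=> x /= /le_trans; apply.
Qed.

Lemma radial_cdf_ge0 r : 0 <= F r.
Proof. by rewrite -lee_fin -mu_le measure_ge0. Qed.

Lemma radial_cdf_le1 r : F r <= 1.
Proof. by rewrite -lee_fin -mu_le probability_le1//; have [] :=
  measurable_enorm_rel r. Qed.

Lemma radial_cdf0 : F 0 = 0.
Proof.
rewrite /F (_ : mkset _ = [set x | enorm x = 0]) ?sphere_null//.
apply/seteqP; split=> x /= => [x0|->//].
by apply/eqP; rewrite eq_le x0 enorm_ge0.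
Qed.

(** Left continuity: as spheres are null, F r is also the mass of the open ball, an increasing union
    of closed balls. *)
Lemma radial_cdf_left r a : a < F r -> exists2 s, s < r & a < F s.
Proof.
rewrite -lte_fin -mu_lt => ar.
have UE : [set x | enorm x < r] = \bigcup_n [set x : 'rV[R]_d | enorm x <= r - n.+1%:R^-1].
  apply/seteqP; split=> [x /= xr|x [n _ /=]].
    by have [k hk] := ltr_add_invr xr; exists k => //=; rewrite lerBrDr ltW.
  by move=> h; apply: (le_lt_trans h); rewrite ltrBlDr ltrDl invr_gt0 ltr0n.
move: ar; rewrite UE => /lt_measure_bigcup[n|m n mn|n].
- by have [] := measurable_enorm_rel (r - n.+1%:R^-1).
- apply/subsetPset => x /= /le_trans; apply.
  by rewrite lerB// lef_pV2 ?posrE// ler_nat.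
- rewrite mu_le lte_fin => h; exists (r - n.+1%:R^-1) => //.
  by rewrite ltrBlDr ltrDl invr_gt0 ltr0n.
Qed.

Lemma radial_cdf_right r a : F r < a -> exists2 s, r < s & F s < a.
Proof.
move=> ra; have ar : ((1 - a)%:E < mu [set x | (r < enorm x)%R])%E.
  by rewrite mu_gt lte_fin; lra.
have UE : [set x | r < enorm x] = \bigcup_n [set x : 'rV[R]_d | r + n.+1%:R^-1 < enorm x].
  apply/seteqP; split=> [x /= xr|x [n _ /=]].
    by have [k hk] := ltr_add_invr xr; exists k.
  by apply: lt_trans; rewrite ltrDl invr_gt0 ltr0n.
move: ar; rewrite UE => /lt_measure_bigcup[n|m n mn|n].
- by have [] := measurable_enorm_rel (r + n.+1%:R^-1).
- apply/subsetPset => x /=; apply: le_lt_trans.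
  by rewrite lerD// lef_pV2 ?posrE// ler_nat.
- rewrite mu_gt lte_fin => h; exists (r + n.+1%:R^-1); last by lra.
  by rewrite ltrDl invr_gt0 ltr0n.
Qed.

Lemma radial_cdf_top a : a < 1 -> exists2 r, 0 <= r & a < F r.
Proof.
rewrite -lte_fin -(probability_setT mu)
  (_ : setT = \bigcup_n [set x : 'rV[R]_d | enorm x <= n%:R]).
  move=> /lt_measure_bigcup[n|m n mn|n].
  - by have [] := measurable_enorm_rel n%:R.
  - by apply/subsetPset => x /= /le_trans; apply; rewrite ler_nat.
  - by rewrite mu_le lte_fin => h; exists n%:R.
apply/seteqP; split=> x // _; exists (Num.truncn (enorm x)).+1 => //=.
exact/ltW/truncnS_gt.
Qed.

(* Points of one level set of F either have a rational radius of the same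
   level above them, or all lie on a single sphere. *)
Lemma ae_radial_cdf_increasing :
  {ae mu, forall x, forall q : rat, ratr q < enorm x -> F (ratr q) < F (enorm x)}.
Proof.
pose J (q t : rat) := [set x : 'rV[R]_d | ratr q < enorm x <= ratr t /\ F (ratr q)
  = F (ratr t)].
pose K (q : rat) := [set x : 'rV[R]_d | [/\ ratr q < enorm x, F (ratr q) = F (enorm x) &
   forall t : rat, enorm x <= ratr t -> F (ratr q) <> F (ratr t)]].
have J0 q t : mu.-negligible (J q t).
  have [Fqt|Fqt] := pselect (F (ratr q) = F (ratr t)); last first.
    by apply: (negligibleS _ (negligible_set0 _)) => x [].
  have [m1 _ _ m4] := measurable_enorm_rel (ratr q).
  have [m1' _ _ m4'] := measurable_enorm_rel (ratr t).
  have mI : measurable ([set x : 'rV[R]_d | enorm x <= ratr t] `\` [set x | enorm x <= ratr q]).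
    exact: measurableD.
  apply: (@negligibleS _ _ _ _ _ _ _ (proj2 (negligibleP _ mI) _)).
    by move=> x [/= /andP[qx xt] _]; split=> //=; apply/negP; rewrite -ltNge.
  have [qt|tq] := leP (ratr q : R) (ratr t).
    rewrite measureD//; last by rewrite -ge0_fin_numE// fin_num_measure.
    rewrite setIidr; first by rewrite [X in (X - _)%E]mu_le [X in (_ - X)%E]mu_le -EFinB Fqt subrr.
    by move=> x /= /le_trans; apply.
  rewrite (_ : _ `\` _ = set0) ?measure0//; apply/seteqP; split=> x //= [xt []].
  exact: le_trans xt (ltW tq).
have K0 q : mu.-negligible (K q).
  have [->|/set0P[x0 [q0 F0 h0]]] := eqVneq (K q) set0; first exact: negligible_set0.
  have mS : measurable [set x : 'rV[R]_d | enorm x = enorm x0].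
    by apply: measurable_level; exact: measurable_enorm.
  apply: (@negligibleS _ _ _ _ _ _ _ (proj2 (negligibleP _ mS) (sphere_null _))).
  move=> x [qx Fx hx] /=.
  have key (y z : 'rV[R]_d) : K q y -> K q z -> enorm y < enorm z -> False.
    move=> [qy Fy hy] [qz Fz hz] /rat_in_itvoo[t]; rewrite in_itv/= => /andP[yt tz].
    apply: (hy t (ltW yt)); apply/eqP; rewrite eq_le Fy radial_cdf_le ?(ltW yt)//=.
    by rewrite -Fy Fz radial_cdf_le// ltW.
  by case: (ltgtP (enorm x) (enorm x0)) => // h; exfalso;
    [apply: (key x x0)|apply: (key x0 x)].
have H (q : rat) : mu.-negligible [set x | ~ (ratr q < enorm x -> F (ratr q)
  < F (enorm x))].
  apply: negligibleS (negligibleU (K0 q) (negligible_countable (J0 q))).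
  move=> x /= /not_implyP[qx /negP]; rewrite -leNgt => Fx.
  have {}Fx : F (ratr q) = F (enorm x).
    by apply/eqP; rewrite eq_le Fx radial_cdf_le// ltW.
  have [[t [xt Ft]]|h] := pselect (exists t : rat, enorm x <= ratr t /\ F (ratr q)
    = F (ratr t)).
    by right; exists t => //; split=> //; rewrite qx.
  by left; split=> // t xt Ft; apply: h; exists t.
apply: negligibleS (negligible_countable H).
by move=> x /= /existsNP[q hq]; exists q.
Qed.

End radial_cdf.

Section antitone_cdf.
Context {R : realType} (d : nat).
Variables (mu : probability 'rV[R]_d R)
  (gamma : probability ('rV[R]_d * 'rV[R]_d)%type R).
Hypothesis sphere_null : forall r, mu [set x | enorm x = r] = 0%E.
Hypothesis gamma_plan : transport_plan mu gamma.
Hypothesis gamma_anti : (gamma \x gamma)%E.-negligible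
  [set w | enorm w.1.1 < enorm w.2.1 /\ enorm w.1.2 < enorm w.2.2].

(** For almost every (x, y), points with both radii larger have total mass 0, and so do those with
    both smaller. Hence almost every (x', y') with |y'| > |y| has |x'| <= |x|, so 1 - F |y| <= F
    |x|; the other half gives F |y| <= 1 - F |x|. *)
Lemma ae_radial_cdf_antitone :
  {ae gamma, forall p, radial_cdf mu (enorm p.1) + radial_cdf mu (enorm p.2) = 1}.
Proof.
pose Rel := [set w : ('rV[R]_d * 'rV[R]_d) * ('rV[R]_d * 'rV[R]_d) |
  enorm w.1.1 < enorm w.2.1 /\ enorm w.1.2 < enorm w.2.2].
have mRel : measurable Rel.
  have m11 : measurable_fun setT (fun w : ('rV[R]_d * 'rV[R]_d)
    * ('rV[R]_d * 'rV[R]_d) => enorm w.1.1).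
    by apply: measurable_enorm; exact: measurableT_comp.
  have m12 : measurable_fun setT (fun w : ('rV[R]_d * 'rV[R]_d)
    * ('rV[R]_d * 'rV[R]_d) => enorm w.1.2).
    by apply: measurable_enorm; exact: measurableT_comp.
  have m21 : measurable_fun setT (fun w : ('rV[R]_d * 'rV[R]_d)
    * ('rV[R]_d * 'rV[R]_d) => enorm w.2.1).
    by apply: measurable_enorm; exact: measurableT_comp.
  have m22 : measurable_fun setT (fun w : ('rV[R]_d * 'rV[R]_d)
    * ('rV[R]_d * 'rV[R]_d) => enorm w.2.2).
    by apply: measurable_enorm; exact: measurableT_comp.
  apply: measurableI.
    exact: (measurable_preimageT (A := [set true]) (measurable_fun_ltr m11 m21)).
  exact: (measurable_preimageT (A := [set true]) (measurable_fun_ltr m12 m22)).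
have [ae1 ae2] := ae_section_null mRel (proj1 (negligibleP _ mRel) gamma_anti).
apply: filterS2 ae1 ae2 => -[x y] /=.
have [m1 m2 m3 m4] := measurable_enorm_rel d (enorm x).
have [m1' m2' m3' m4'] := measurable_enorm_rel d (enorm y).
have mfst (A : set 'rV[R]_d) : measurable A ->
  measurable ((fst : 'rV[R]_d * 'rV[R]_d -> _) @^-1` A).
  by move=> mA; exact: measurable_preimageT.
have msnd (A : set 'rV[R]_d) : measurable A ->
  measurable ((snd : 'rV[R]_d * 'rV[R]_d -> _) @^-1` A).
  by move=> mA; exact: measurable_preimageT.
have mx := measurable_xsection (x, y) mRel; have my := measurable_ysection (x, y) mRel.
have xE q : xsection Rel (x, y) q <-> enorm x < enorm q.1 /\ enorm y < enorm q.2.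
  by rewrite /xsection/= inE.
have yE q : ysection Rel (x, y) q <-> enorm q.1 < enorm x /\ enorm q.2 < enorm y.
  by rewrite /ysection/= inE.
move=> x0 y0.
have g1 (A : set 'rV[R]_d) : measurable A -> gamma (fst @^-1` A) = mu A.
  by move=> mA; have [] := gamma_plan mA.
have g2 (A : set 'rV[R]_d) : measurable A -> gamma (snd @^-1` A) = mu A.
  by move=> mA; have [] := gamma_plan mA.
have le1 : (mu [set z | (enorm y < enorm z)%R] <= mu [set z | (enorm z <= enorm x)%R])%E.
  rewrite -g2// -g1// -[leRHS](measureU0 (mfst _ m1) mx x0).
  apply: le_measure; rewrite ?inE; [exact: msnd|by apply: measurableU => //;
    exact: mfst|].
  move=> q /= yq; have [qx|xq] := leP (enorm q.1) (enorm x); [by left|right].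
  exact/xE.
have le2 : (mu [set z | (enorm z < enorm y)%R] <= mu [set z | (enorm x <= enorm z)%R])%E.
  rewrite -g2// -g1// -[leRHS](measureU0 (mfst _ m3) my y0).
  apply: le_measure; rewrite ?inE; [exact: msnd|by apply: measurableU => //;
    exact: mfst|].
  move=> q /= yq; have [qx|xq] := leP (enorm x) (enorm q.1); [by left|right].
  exact/yE.
move: le1 le2; rewrite mu_gt// mu_le// mu_lt// mu_ge// !lee_fin => le1 le2.
by apply/eqP; rewrite eq_le; apply/andP; split; lra.
Qed.

End antitone_cdf.

(** * The decreasing rearrangement of the radius *)

Section rearrangement.
Context {R : realType} (d : nat) (mu : probability 'rV[R]_d R).
Hypothesis sphere_null : forall r, mu [set x | enorm x = r] = 0%E.
Local Notation F := (radial_cdf mu).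

(* The values at radii below the support of mu only matter for the monotonicity
   and the limit at 0+ of the rearrangement; b stands for a bound of the
   support. *)
Definition rearrangement (b r : R) : R :=
  if F r == 0 then b + r^-1 else inf [set s | 0 <= s /\ 1 - F r <= F s].
Local Notation G := rearrangement.

Let S r := [set s | 0 <= s /\ 1 - F r <= F s].

Let S_lbound r : lbound (S r) 0.
Proof. by move=> s []. Qed.

Let S_has_inf r : 0 < F r -> has_inf (S r).
Proof.
move=> Fr0; split; last by exists 0; exact: S_lbound.
have [s s0 rs] := radial_cdf_top mu (a := 1 - F r) (ltac:(lra)).
by exists s; split=> //; exact: ltW.
Qed.

Let GE b r : 0 < F r -> G b r = inf (S r).
Proof. by move=> Fr0; rewrite /G gt_eqF. Qed.

Let G_le b r s : 0 < F r -> 0 <= s -> 1 - F r <= F s -> G b r <= s.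
Proof. by move=> Fr0 s0 rs; rewrite GE//; apply: ge_inf => //;
  exact: (S_has_inf Fr0).2. Qed.

Let le_G b r s : 0 < F r -> (forall t, 0 <= t -> 1 - F r <= F t -> s <= t) ->
  s <= G b r.
Proof.
move=> Fr0 h; rewrite GE//; apply: lb_le_inf; first exact: (S_has_inf Fr0).1.
by move=> t [t0 rt]; exact: h.
Qed.

Lemma rearrangement_ge0 b r : 0 <= b -> 0 <= r -> 0 <= G b r.
Proof.
move=> b0 r0; have [F0|F0] := eqVneq (F r) 0.
  by rewrite /G F0 eqxx addr_ge0// invr_ge0.
by apply: le_G => //; rewrite lt_neqAle eq_sym F0 radial_cdf_ge0.
Qed.

(** The last hypothesis says that s is the least radius of its level, hence the infimum. *)
Lemma rearrangement_eq b r s : 0 < F r -> 0 <= s -> F s = 1 - F r ->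
  (forall q : rat, ratr q < s -> F (ratr q) < F s) -> G b r = s.
Proof.
move=> Fr0 s0 Fs hs; apply/eqP; rewrite eq_le G_le ?Fs//=.
apply: le_G => // t t0 rt; rewrite leNgt; apply/negP => /rat_in_itvoo[q].
rewrite in_itv/= => /andP[tq /hs]; rewrite Fs.
by rewrite ltNge (le_trans rt)// radial_cdf_le// ltW.
Qed.

Let F_rearrangement b r : 0 < F r -> 1 - F r <= F (G b r).
Proof.
move=> Fr0; rewrite leNgt; apply/negP => /radial_cdf_right[s Gs Fs].
have := @inf_adherent _ (S r) (s - G b r) _ (S_has_inf Fr0).
rewrite subr_gt0 -(GE b Fr0) => /(_ Gs)[t [t0 rt]].
rewrite addrC subrK => ts; move: Fs; rewrite ltNge (le_trans rt)//.
by rewrite radial_cdf_le// ltW.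
Qed.

Lemma rearrangement_le b r s : 0 < r -> r <= s ->
  0 < F r \/ (0 <= b /\ F b = 1) -> G b s <= G b r.
Proof.
move=> r0 rs hr; have Frs : F r <= F s by exact: radial_cdf_le.
have s0 : 0 < s by exact: lt_le_trans rs.
have [Fr0|Fr0] := eqVneq (F r) 0; last first.
  have Fr_gt0 : 0 < F r by rewrite lt_neqAle eq_sym Fr0 radial_cdf_ge0.
  have Fs_gt0 : 0 < F s by exact: lt_le_trans Frs.
  by apply: le_G => // t t0 rt; apply: G_le => //; lra.
case: hr => [|[b0 Fb]]; first by rewrite Fr0 ltxx.
have [Fs0|Fs0] := eqVneq (F s) 0.
  by rewrite /G Fr0 Fs0 eqxx lerD2l lef_pV2 ?posrE.
have Fs_gt0 : 0 < F s by rewrite lt_neqAle eq_sym Fs0 radial_cdf_ge0.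
apply: (@le_trans _ _ b); first by apply: G_le => //; rewrite Fb; lra.
by rewrite /G Fr0 eqxx lerDl invr_ge0 ltW.
Qed.

(** When F r > 0, right continuity gives F (G r) >= 1 - F r > 1 - F s, and left continuity leaves
    room for some t < G r admissible for s. When F r = 0, the bound b separates the two values. *)
Lemma rearrangement_lt b r s : 0 < r -> F r < F s ->
  0 < F r \/ (0 <= b /\ F b = 1) -> G b s < G b r.
Proof.
move=> r0 Frs hr; have Fs_gt0 : 0 < F s by exact: le_lt_trans (radial_cdf_ge0 _ _) Frs.
have [Fr0|Fr0] := eqVneq (F r) 0; last first.
  have Fr_gt0 : 0 < F r by rewrite lt_neqAle eq_sym Fr0 radial_cdf_ge0.
  have : 1 - F s < F (G b r) by have := F_rearrangement b Fr_gt0; lra.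
  move=> /(radial_cdf_left sphere_null)[t tG Ft]; apply: le_lt_trans tG.
  apply: G_le => //; last exact: ltW.
  rewrite leNgt; apply/negP => t0.
  have := radial_cdf_le mu (ltW t0); rewrite radial_cdf0//.
  by have := radial_cdf_le1 mu s; lra.
case: hr => [|[b0 Fb]]; first by rewrite Fr0 ltxx.
apply: (@le_lt_trans _ _ b); first by apply: G_le => //; rewrite Fb; lra.
by rewrite /G Fr0 eqxx ltrDl invr_gt0.
Qed.

Lemma rearrangement_cvg0 b : 0 <= b ->
  (forall r, F r < 1) \/ (exists2 r, 0 < r & F r = 0) ->
  - G b r @[r --> 0^'+] --> -oo.
Proof.
move=> b0 h; apply/cvgrNyPle => A.
have [[r0 r0_gt0 Fr0]|hF] := pselect (exists2 r, 0 < r & F r = 0).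
  near=> r; have r_gt0 : 0 < r by near: r; exact: nbhs_right_gt.
  have -> : G b r = b + r^-1.
    rewrite /G ifT// eq_le radial_cdf_ge0 andbT -Fr0 radial_cdf_le//.
    by near: r; exact: nbhs_right_ltW.
  have rA : r < (`|A| + 1)^-1.
    near: r; apply: nbhs_right_lt; rewrite invr_gt0.
    by have := normr_ge0 A; lra.
  have Ar : `|A| + 1 < r^-1.
    by rewrite -[ltLHS]invrK ltf_pV2 ?posrE// invr_gt0; have := normr_ge0 A; lra.
  by have := ler_norm (- A); rewrite normrN; lra.
(* Right continuity at 0 gives t > 0 with F t < 1 - F |A|; for r <= t, every admissible s then
   exceeds |A|. *)
case: h => // h; have := h `|A|; rewrite -subr_gt0 -{1}(radial_cdf0 sphere_null).
move=> /radial_cdf_right[t t0 Ft].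
near=> r; have r_gt0 : 0 < r by near: r; exact: nbhs_right_gt.
have rt : r <= t by near: r; exact: nbhs_right_ltW.
have Fr_gt0 : 0 < F r.
  rewrite lt_neqAle radial_cdf_ge0 andbT; apply/negP => /eqP Fr0.
  by apply: hF; exists r.
have : `|A| <= G b r.
  apply: le_G => // s s0 rs; rewrite leNgt; apply/negP => sA.
  have := radial_cdf_le mu rt; have := radial_cdf_le mu (ltW sA); lra.
by have := ler_norm (- A); rewrite normrN; lra.
Unshelve. all: by end_near. Qed.

Lemma rearrangement_cvgy b : 0 <= b ->
  (exists r, F r = 1) \/ (forall r, 0 < r -> 0 < F r) ->
  - G b r @[r --> +oo] --> 0.
Proof.
move=> b0 h; apply/cvgr0Pnorm_le => e e0.
have [r0 hr0] : exists r0, 0 < F r0 /\ 1 - F r0 <= F e.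
  case: h => [[r Fr]|h]; first by exists r; rewrite Fr subrr radial_cdf_ge0 ltr01.
  have [r r_ge0 Fr] := radial_cdf_top mu (a := 1 - F e) (ltac:(have := h e e0; lra)).
  exists r; split; last lra.
  by have := h e e0; have := radial_cdf_le1 mu e; lra.
near=> r; have r_gt0 : 0 <= r by near: r; apply: nbhs_pinfty_ge; exact: num_real.
have /(radial_cdf_le mu) Fr : r0 <= r by near: r; apply: nbhs_pinfty_ge;
  exact: num_real.
rewrite normrN ger0_norm ?rearrangement_ge0//.
by apply: G_le; [lra|exact: ltW|lra].
Unshelve. all: by end_near. Qed.

End rearrangement.

(** * The support *)

Section enorm_topology.
Context {R : realType} (d : nat).
Implicit Types x y : 'rV[R]_d.

Lemma enorm_continuous : continuous (@enorm R d).
Proof.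
have -> : @enorm R d = (fun x => Num.sqrt (dot x x)) by apply/funext => x;
  exact: enorm_dot.
move=> x; apply: (@continuous_comp _ _ _ (fun x : 'rV[R]_d => dot x x)).
  by apply: continuous_dot => ?; exact: cvg_id.
exact: sqrt_continuous.
Qed.

Lemma open_enorm_lt r : open [set x : 'rV[R]_d | enorm x < r].
Proof.
apply: (@open_comp _ _ (@enorm R d) [set s | s < r]); last exact: open_lt.
by move=> x _; exact: enorm_continuous.
Qed.

Lemma open_enorm_gt r : open [set x : 'rV[R]_d | r < enorm x].
Proof.
apply: (@open_comp _ _ (@enorm R d) [set s | r < s]); last exact: open_gt.
by move=> x _; exact: enorm_continuous.
Qed.

Lemma coord_le_enorm x (i : 'I_d) : `|x 0 i| <= enorm x.
Proof.
rewrite enorm_dot -sqrtr_sqr ler_sqrt ?dot_ge0// dotE (bigD1 i)//= expr2 lerDl.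
by rewrite sumr_ge0// => j _; rewrite -expr2 sqr_ge0.
Qed.

(** [bounded_set] and [ball] refer to the sup norm, hence this comparison and its converse. *)
Lemma norm_le_enorm x : `|x| <= enorm x.
Proof.
rewrite [`|x|]mx_normrE; apply/bigmax_leP; split=> [|[i j] _]; first exact: enorm_ge0.
by rewrite ord1 coord_le_enorm.
Qed.

Lemma enorm_le_norm x : enorm x <= Num.sqrt d%:R * `|x|.
Proof.
rewrite -[X in _ * X]ger0_norm// -sqrtr_sqr -sqrtrM// enorm_dot ler_sqrt; last first.
  by rewrite mulr_ge0// sqr_ge0.
rewrite dotE mulr_natl -[X in _ *+ X]card_ord -sumr_const ler_sum// => i _.
rewrite -expr2 -real_normK ?num_real// lerXn2r ?nnegrE//.
by rewrite [`|x|]mx_normrE; apply: (le_bigmax _ (fun ij => `|x ij.1 ij.2|) (0, i)).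
Qed.

End enorm_topology.

Section support.
Context {R : realType} (d : nat) (mu : probability 'rV[R]_d R).
Local Notation F := (radial_cdf mu).

Lemma closed_measurable_rV (C : set 'rV[R]_d) : closed C -> measurable C.
Proof.
by move=> cC; rewrite -[C]setCK; apply: measurableC; apply: open_measurable_rV;
  exact: closed_openC.
Qed.

Lemma msupport_gt0 (U : set 'rV[R]_d) x :
  open U -> U x -> msupport mu x -> (0 < mu U)%E.
Proof.
move=> oU Ux sx; rewrite lt_neqAle measure_ge0 andbT; apply/eqP => U0.
have mU := open_measurable_rV oU.
have : (~` U) x by apply: sx; split;
  [exact: open_closedC|rewrite probability_setC// -U0 sube0].
exact.
Qed.

(** The complement is an uncountable union of null open sets; countably many null balls with
    rational centres already cover it. *)
Lemma msupport_negligible : mu.-negligible (~` msupport mu).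
Proof.
pose B (i : 'rV[rat]_d * nat) := ball (map_mx ratr i.1 : 'rV[R]_d) i.2.+1%:R^-1.
pose N i := if `[< mu.-negligible (B i) >] then B i else set0.
apply: (@negligibleS _ _ _ _ _ _ _ (@negligible_countable _ _ _ mu _ N _)); last first.
  by move=> i; rewrite /N; case: asboolP => // _; exact: negligible_set0.
move=> x /existsNP[C /not_implyP[[cC C1] nCx]].
have mC := closed_measurable_rV cC.
have /nbhs_ballP[e /= e0 eC] : nbhs x (~` C).
  by apply: open_nbhs_nbhs; split=> //; exact: closed_openC.
have [n] := ltr_add_invr (divr_gt0 e0 (ltr0Sn R 1)); rewrite add0r => ne.
have n0 : 0 < n.+1%:R^-1 :> R by rewrite invr_gt0 ltr0n.
have [w /ball_sym xw] := exists_rat_approx (nbhsx_ballx x _ n0).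
have BN : mu.-negligible (B (w, n)).
  apply: (@negligibleS _ _ _ _ (~` C)) => [y wy|].
    apply: eC; apply: (@le_ball _ _ _ (n.+1%:R^-1 + n.+1%:R^-1)).
      by rewrite [leRHS]splitr lerD// ltW.
    exact: ball_triangle (ball_sym xw) wy.
  by apply/negligibleP;
    [exact: measurableC|rewrite [LHS]probability_setC// [X in (_ - X)%E]C1 subee].
by exists (w, n) => //; rewrite /N asboolT.
Qed.

Lemma msupport_cdf_gt0 x r : msupport mu x -> enorm x < r -> 0 < F r.
Proof.
move=> sx xr; have [m1 m2 _ _] := measurable_enorm_rel d r.
rewrite -lte_fin -mu_le; apply: lt_le_trans (msupport_gt0 (open_enorm_lt (r := r))
  xr sx) _.
by apply: le_measure; rewrite ?inE// => y /= /ltW.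
Qed.

Lemma msupport_cdf_lt x r s : msupport mu x -> r < enorm x < s -> F r < F s.
Proof.
move=> sx /andP[rx xs].
have [m1 _ _ m4] := measurable_enorm_rel d r; have [m1' m2' _ _] :=
  measurable_enorm_rel d s.
have mA : measurable ([set y : 'rV[R]_d | r < enorm y] `&` [set y | enorm y < s]).
  exact: measurableI.
have A0 := msupport_gt0 (openI (open_enorm_gt (r := r)) (open_enorm_lt (r := s)))
  (conj rx xs) sx.
rewrite -lte_fin -!mu_le; apply: (@lt_le_trans _ _
    (mu ([set y | enorm y <= r] `|` ([set y | r < enorm y] `&` [set y | enorm y < s])))).
  rewrite measureU//; last first.
    by apply/seteqP; split=> y //= [yr []]; rewrite ltNge yr.
  by rewrite lteDl// fin_num_measure.
apply: le_measure; rewrite ?inE//; first exact: measurableU.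
by move=> y /= [yr|[_ /ltW//]]; apply: le_trans yr _; rewrite ltW// (lt_trans rx).
Qed.

Lemma msupport_cdf_eq0 : ~ msupport mu 0 -> exists2 r, 0 < r & F r = 0.
Proof.
move=> /existsNP[C /not_implyP[[cC C1] nC0]].
have mC := closed_measurable_rV cC.
have /nbhs_ballP[e /= e0 eC] : nbhs (0 : 'rV[R]_d) (~` C).
  by apply: open_nbhs_nbhs; split=> //; exact: closed_openC.
exists (e / 2); first exact: divr_gt0.
apply/eqP; rewrite eq_le radial_cdf_ge0 andbT -lee_fin -mu_le.
have [m1 _ _ _] := measurable_enorm_rel d (e / 2).
apply: (@le_trans _ _ (mu (~` C))).
  apply: le_measure; rewrite ?inE//; first exact: measurableC.
  move=> y /= ye; apply: eC; rewrite -ball_normE/= sub0r normrN.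
  by apply: le_lt_trans (norm_le_enorm y) _; apply: le_lt_trans ye _;
    rewrite ltr_pdivrMr// ltr_pMr// ltr1n.
by rewrite probability_setC// C1 subee.
Qed.

Lemma msupport_bounded_cdf : bounded_set (msupport mu) -> exists2 b, 0 <= b & F b = 1.
Proof.
move=> [M [_ hM]]; pose b := Num.sqrt d%:R * (`|M| + 1).
have M1 : 0 <= `|M| + 1 by rewrite addr_ge0.
exists b; first by rewrite mulr_ge0// sqrtr_ge0.
apply/eqP; rewrite eq_le radial_cdf_le1/=.
have : (mu [set x | (b < enorm x)%R] = 0)%E.
  have [_ _ _ m4] := measurable_enorm_rel d b.
  apply/(negligibleP _ m4); apply: negligibleS msupport_negligible => x /= bx sx.
  move: bx; rewrite ltNge => /negP; apply; apply: le_trans (enorm_le_norm x) _.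
  rewrite ler_wpM2l ?sqrtr_ge0//; apply: hM => //.
  by apply: le_lt_trans (ler_norm M) _; rewrite ltrDl.
by rewrite mu_gt => -[]; lra.
Qed.

Lemma msupport_unbounded_cdf : ~ bounded_set (msupport mu) -> forall r, F r < 1.
Proof.
move=> nb r; rewrite lt_neqAle radial_cdf_le1 andbT; apply/eqP => Fr; apply: nb.
exists r; split; first exact: num_real.
move=> M rM x sx /=; apply: le_trans (norm_le_enorm x) _; apply: le_trans (ltW rM).
have : [set y : 'rV[R]_d | enorm y <= r] x; last by [].
apply: sx; split; last by rewrite mu_le Fr.
rewrite (_ : mkset _ = ~` [set y | r < enorm y]);
  first exact/open_closedC/open_enorm_gt.
by apply/seteqP; split=> y /=; rewrite leNgt => /negP.
Qed.

End support.

(* If supp mu is unbounded and contains 0 -- in particular if it is R^d -- then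
   all the guards in the last three clauses hold, and these clauses read: g is
   increasing on ]0, +oo[ (strictly so across radii met by supp mu),
   g(0+) = -oo and g(+oo) = 0.  For other supports the clauses fail exactly
   where they are guarded: if supp mu is the ball of radius r about 0,
   then |T| <= r almost everywhere, so g(0+) = - r; if supp mu is the set
   |x| >= r with r > 0, then g(+oo) = - r, and g(r+) = -oo, so that a real-valued g cannot be increasing
   on ]0, r] as well. *)
Theorem theorem4p10 (R : realType) (d : nat) (l : \bar R -> \bar R)
    (mu : probability 'rV[R]_d R) (rho : 'rV[R]_d -> R) (lambda : R -> R)
    (T : 'rV[R]_d -> 'rV[R]_d) :
  (0 < d)%N ->
  profile_range l ->
  profile_regular l ->
  cost_C1_off_diagonal d l ->
  cost_lsc d l ->
  cost_diagonal d l ->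
  radially_symmetric mu ->
  has_density mu rho ->
  (forall x, msupport mu x -> rho x = lambda (enorm x)) ->
  (forall x, msupport mu x -> 0 < rho x) ->
  optimal_map (cost l) mu T ->
  exists g : R -> R,
    [/\ {ae mu, forall x, T x = (g (enorm x) / enorm x) *: x},
        forall r, 0 <= r -> g r <= 0,
        forall r s, 0 < r -> r < s ->
          bounded_set (msupport mu) \/
            (exists2 x, msupport mu x & enorm x < r) ->
          g r <= g s /\
          ((exists2 x, msupport mu x & r < enorm x < s) -> g r < g s),
        ~ bounded_set (msupport mu) \/ ~ msupport mu 0 ->
          g r @[r --> 0^'+] --> -oo &
        bounded_set (msupport mu) \/ msupport mu 0 ->
          g r @[r --> +oo] --> 0].
Proof.
move=> d0 l_range l_reg _ _ l_diag mu_radial mu_dens _ _ [mT muT [gamma gammaE gamma_opt]].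
have sphere_null r := has_density_sphere_null r d0 mu_dens.
(* For an unbounded support the value of b is immaterial, and 0 is taken. *)
have [b [b0 bP]] : exists b, 0 <= b /\ (bounded_set (msupport mu) ->
  radial_cdf mu b = 1).
  have [/msupport_bounded_cdf[b b0 Fb]|nb] := pselect (bounded_set (msupport mu)).
    by exists b.
  by exists 0.
exists (fun r => - rearrangement mu b r); split.
- have ae_graph (P : 'rV[R]_d * 'rV[R]_d -> Prop) : {ae gamma, forall p, P p} ->
      {ae mu, forall x, P (x, T x)}.
    move=> [N [mN N0 NP]]; exists ((fun x => (x, T x)) @^-1` N); split.
    - by apply: measurable_preimageT => //; exact: measurable_fun_pair.
    - by have := esym (gammaE N mN); rewrite N0.
    - by move=> x /= Px; exact: NP.
  (* Because T preserves [mu], the radius of T x is also almost surely the least of its level, as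
     [rearrangement_eq] requires. *)
  have ae_T (P : 'rV[R]_d -> Prop) : {ae mu, forall x, P x} -> {ae mu, forall x,
    P (T x)}.
    move=> [N [mN N0 NP]]; exists (T @^-1` N); split.
    - exact: measurable_preimageT.
    - by rewrite -[LHS]/(pushforward mu T N) muT.
    - by move=> x /= Px; exact: NP.
  have ae1 := ae_graph _ (gamma_antiparallel l_range l_reg l_diag mu_radial sphere_null gamma_opt).
  have ae2 := ae_graph _ (ae_radial_cdf_antitone sphere_null (proj1 gamma_opt)
    (gamma_antitone l_range l_reg l_diag mu_radial sphere_null gamma_opt)).
  have ae3 := ae_radial_cdf_increasing sphere_null.
  apply: filterS3 (filterI ae1 ae2) ae3 (ae_T _ ae3) => x [/= [x0 Tx] FT] Fx FTx.
  rewrite {1}Tx (@rearrangement_eq _ _ _ b (enorm x) (enorm (T x)))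
    ?enorm_ge0// ?mulNr//.
  (* The rational q = 0 gives 0 = F 0 < F |x|. *)
  + have := Fx 0; rewrite raddf0 radial_cdf0//; apply; by rewrite enorm_gt0.
  + by rewrite -FT addrC addKr.
- by move=> r r0; rewrite oppr_le0 rearrangement_ge0.
- move=> r s r0 rs hr.
  have hF : 0 < radial_cdf mu r \/ 0 <= b /\ radial_cdf mu b = 1.
    case: hr => [/bP Fb|[x sx xr]]; first by right.
    by left; exact: msupport_cdf_gt0 xr.
  split; first by rewrite lerN2 rearrangement_le// ltW.
  by move=> [x sx /(msupport_cdf_lt sx) Frs]; rewrite ltrN2 rearrangement_lt.
- move=> h; apply: rearrangement_cvg0 => //.
  case: h => [/msupport_unbounded_cdf|/msupport_cdf_eq0]; by [left|right].
- move=> h; apply: rearrangement_cvgy => //.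
  case: h => [/bP Fb|s0]; first by left; exists b.
  by right=> r r0; apply: (msupport_cdf_gt0 s0); rewrite enorm0.
Qed.
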